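(* Let $\beta>0$ and let $r_\beta^{\pm}$ be the pair of Beurling-Selberg functions (defined in the context). Then $$\frac12 M(r_{\beta}^{\pm}) = \Big( \beta \pm \frac{1}{2} \Big) - \frac{1}{2\pi^2 \beta} + \frac{\sin 2\pi\beta }{4\pi^3\beta^2} - \frac{1}{4\pi^2} \sum_{n \in\mathbb{Z}} \frac{\operatorname{sgn}(n^{\pm})}{(n-\beta)^2}\left( 2 + \frac{\sin 2\pi \beta}{\pi (n - \beta)}\right)$$ $$= \beta - \frac12 \pm \frac12 + \frac{1}{2 \pi^2 \beta} + O\!\left(\frac{1}{\beta^2 }\right),$$ where $\operatorname{sgn}(0^{\pm})=\pm1$ and $\operatorname{sgn}(n^\pm)=\operatorname{sgn}(n)$ for $n\neq0$.
   Context: For an integrable function $R$ with Fourier transform $\widehat R(t)=\int_{-\infty}^\infty e^{-2\pi i xt}R(x)\,dx$ supported in $[-1,1]$, put $$M(R)=\int_{-\infty}^\infty R(x)\left\{1-\left(\frac{\sin\pi x}{\pi x}\right)^2\right\}dx.$$ Define the entire functions $$H_0(z)=\left(\frac{\sin\pi z}{\pi}\right)^2\left\{\sum_{m=-\infty}^\infty\frac{\operatorname{sgn}(m)}{(z-m)^2}+\frac{2}{z}\right\},\qquad H_1(z)=\left(\frac{\sin\pi z}{\pi z}\right)^2,$$ with $\operatorname{sgn}(0)=0$, set $H^\pm=H_0\pm H_1$, and for $\beta>0$ define $$r_\beta^{\pm}(x)=\tfrac12\big\{H^{\pm}(x+\beta)+H^{\pm}(-x+\beta)\big\}.$$ The functions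 $r_\beta^\pm$ are integrable on $\mathbb{R}$ with Fourier transforms supported in $[-1,1]$. When $\beta$ is an integer, the term $n=\beta$ of the series is interpreted as its limit, so that the right-hand side of the first formula is a continuous function of $\beta$. The constant implied by $O(1/\beta^2)$ is absolute. *)

(* Defs.v *)
From mathcomp Require Export all_boot all_order all_algebra.
From mathcomp Require Export all_classical all_reals all_analysis.
Export numFieldNormedType.Exports.
Export Order.TTheory GRing.Theory Num.Theory.

Set Implicit Arguments.
Unset Strict Implicit.
Unset Printing Implicit Defensive.

Local Open Scope classical_set_scope.
Local Open Scope ring_scope.

(* A choice of sign +/- is a boolean [s], [false] for + and [true] for -, and
   the corresponding unit is [(-1) ^+ s].

   The entire functions H_0 and H_1 are only ever evaluated on the real line,
   so they are represented by their restrictions to [R]. *)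

Section BeurlingSelberg.
Variable R : realType.
Implicit Types (x beta : R) (n m : int) (s : bool).

(* The bilateral series is the sum of its two halves, n >= 0 and n < 0. All the
   series it is used for converge absolutely. *)
Definition bisum (a : int -> R) : R :=
  limn (fun N => \sum_(0 <= k < N) a (Posz k)) +
  limn (fun N => \sum_(0 <= k < N) a (Negz k)).

(* The value at [x] obtained by removing a singularity of [f] at [x]. *)
Definition removed (f : R -> R) x : R := lim (f y @[y --> x^']).

Definition H0_formula x : R :=
  (sin (pi * x) / pi) ^+ 2 *
  (bisum (fun m => (sgz m)%:~R / (x - m%:~R) ^+ 2) + 2 / x).

(* The singularities of the formula on the real line are the integers. *)
Definition H0 x : R :=
  if x \is a Num.int then removed H0_formula x else H0_formula x.

Definition H1_formula x : R := (sin (pi * x) / (pi * x)) ^+ 2.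

Definition H1 x : R := if x == 0 then removed H1_formula x else H1_formula x.

Definition Hpm s x : R := H0 x + (-1) ^+ s * H1 x.

Definition BSr s beta x : R := 2^-1 * (Hpm s (x + beta) + Hpm s (- x + beta)).

(* Lebesgue integral over the whole line; the value of the integrand at
   [x = 0], where the quotient reads 0/0, is irrelevant. *)
Definition M (f : R -> R) : R :=
  \int[@lebesgue_measure R]_x
    (f x * (1 - (sin (pi * x) / (pi * x)) ^+ 2)).

Definition sgnpm s n : R := if n == 0 then (-1) ^+ s else (sgz n)%:~R.

Definition term_formula s n beta : R :=
  sgnpm s n / (n%:~R - beta) ^+ 2 *
  (2 + sin (2 * pi * beta) / (pi * (n%:~R - beta))).

(* For integral [beta] the term [n = beta] is its limit as the second
   parameter tends to [beta]. *)
Definition term s n beta : R :=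
  if n%:~R == beta then removed (term_formula s n) beta
  else term_formula s n beta.

End BeurlingSelberg.

(* Main.v *)
Require Import Defs.
From mathcomp Require Import measurable_realfun zify ring lra.
Set Implicit Arguments.
Unset Strict Implicit.
Unset Printing Implicit Defensive.
Local Open Scope classical_set_scope.
Local Open Scope ring_scope.

(** Write K(x) = (sin pi x / pi x)^2 for the Fejer kernel, S(x) = (sin pi x / pi)^2
    and psi(x) = sum_(k >= 0) 1/(x+k)^2, so that K(x) = S(x)/x^2 and
    sum_(k >= 0) K(x+k) = S(x) psi(x). The proof is Fourier analysis reduced to
    integrals that can be evaluated by hand. Put e = 1 for r^+, e = -1 for r^-.

    Everything rests on the partial fraction expansion (sinsq_trigamma)
      S(x) (psi(x) + psi(1-x)) = 1 for x not an integer,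
    that is, the translates of K by integers sum to 1. It turns the definition
    of H^+- into
      H^+-(x) = 1 + 2 S(x)/x - (1-e) K(x) - 2 S(x) psi(x+1)         (Hpm_eq),
    and, with 1/x <= psi(x) <= 1/x + 1/x^2 for x > 0, into Beurling's inequality
    |H_0 - sgn| <= K (normr_H0_formula_sgr). It also gives the total mass 1 of K
    (integral_fejer), because the integral of K over the line is the integral
    over [0,1) of the sum of its translates.

    The first half of M, the integral of r = r_beta^+-. As H_0 - sgn is odd and
    integrable, its integral vanishes; H_1 = K contributes e, and the sign
    functions add up to the indicator of (-beta, beta). So this half is
    2 beta + e (Rintegral_BSr_reg).

    The second half, the integral of r K. As K is even, it is the integral of
    H^+-(x+beta) K(x), to be computed term by term in the expansion of H^+-.
    Both K(y) and 2 S(y)/y are Fourier integrals over [0,1], and the transform of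
    K there is 1 - xi (Rintegral_fejerM_cos), so by Fubini
    (Rintegral_fejerM_fourier) each term becomes an elementary integral over
    [0,1]: the autocorrelation c of K is
      c(t) = 1/(pi^2 t^2) - sin(2 pi t)/(2 pi^3 t^3), with a removable singularity,
    and 2 S(x+beta)/(x+beta) contributes
      1/(pi^2 beta) - sin(2 pi beta)/(2 pi^3 beta^2).
    Hence (M_BSr, Rintegral_weighted), with C(t) = sum_(k >= 0) c(t+k),
      M = 2 beta + e - (1 + 1/(pi^2 beta) - sin(2 pi beta)/(2 pi^3 beta^2)
                          - (1-e) c(beta) - 2 C(beta+1)).

    The summand of the theorem's series is 2 pi^2 sgn(n^+-) c(n - beta), also at
    n = beta, since c is continuous at 0 (termE). Because C(t) + C(1-t) = 1, once
    more by the partition of unity (corr_sum_onem), the series is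
    2 pi^2 (1 - (1-e) c(beta) - 2 C(beta+1)), which is the exact formula.

    For the estimate, 0 <= c(beta) <= 2/(pi^2 beta^2), and comparing c with
    1/(pi^2 t^2) termwise gives C(beta+1) = 1/(pi^2 beta) + O(1/beta^2)
    (corr_sum_asymptotic). *)

(** * The series of inverse squares *)

Section Trigamma.
Variable R : realType.
Implicit Types (x : R) (k N : nat).

Definition trigamma_term x k : R := (x + k%:R) ^- 2.

(** For x > 0 this is the trigamma function, the second derivative of log Gamma.
    The series converges for every real x because 0^-1 is 0, so the recurrence
    below needs no side condition. *)
Definition trigamma x : R := limn (series (trigamma_term x)).

Lemma trigamma_termS x k : trigamma_term x k.+1 = trigamma_term (x + 1) k.
Proof. by rewrite /trigamma_term -natr1 [k%:R + 1]addrC addrA. Qed.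

Lemma trigamma_term_ge0 x k : 0 <= trigamma_term x k.
Proof. by rewrite invr_ge0 exprn_even_ge0. Qed.

Lemma series_trigammaS x N :
  series (trigamma_term x) N.+1 = x ^- 2 + series (trigamma_term (x + 1)) N.
Proof.
rewrite /series /= big_nat_recl// {1}/trigamma_term addr0; congr (_ + _).
by apply: eq_bigr => k _; rewrite trigamma_termS.
Qed.

(** Telescoping: 1/(y+1)^2 <= 1/y - 1/(y+1) <= 1/y^2. *)
Lemma series_trigamma_le x N : 0 < x ->
  series (trigamma_term (x + 1)) N <= x^-1 - (x + N%:R)^-1.
Proof.
move=> x0; elim: N => [|N IH]; first by rewrite /series /= big_geq// addr0 subrr.
rewrite seriesSr (le_trans (lerD IH (lexx _)))// /trigamma_term.
set y := x + N%:R; have y0 : 0 < y by rewrite ltr_wpDr.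
have -> : x + 1 + N%:R = y + 1 by rewrite /y; ring.
have -> : x + N.+1%:R = y + 1 by rewrite /y -natr1; ring.
have e : y^-1 - (y + 1)^-1 = (y * (y + 1))^-1 by field; lra.
suff : (y + 1) ^- 2 <= y^-1 - (y + 1)^-1 by lra.
by rewrite e lef_pV2 ?posrE ?exprn_gt0 ?mulr_gt0//; nra.
Qed.

Lemma series_trigamma_ge x N : 0 < x ->
  x^-1 - (x + N%:R)^-1 <= series (trigamma_term x) N.
Proof.
move=> x0; elim: N => [|N IH]; first by rewrite /series /= big_geq// addr0 subrr.
rewrite seriesSr; apply: le_trans (lerD IH (lexx _)); rewrite /trigamma_term.
set y := x + N%:R; have y0 : 0 < y by rewrite ltr_wpDr.
have -> : x + N.+1%:R = y + 1 by rewrite /y -natr1; ring.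
have e : y^-1 - (y + 1)^-1 = (y * (y + 1))^-1 by field; lra.
suff : y^-1 - (y + 1)^-1 <= y ^- 2 by lra.
by rewrite e lef_pV2 ?posrE ?exprn_gt0 ?mulr_gt0//; nra.
Qed.

Lemma nondecreasing_series_trigamma x :
  nondecreasing_seq (series (trigamma_term x)).
Proof. by apply: nondecreasing_series => k _ _; exact: trigamma_term_ge0. Qed.

Lemma cvg_trigamma x : series (trigamma_term x) @ \oo --> trigamma x.
Proof.
suff : forall n : nat, 0 < x + n%:R -> cvgn (series (trigamma_term x)).
  apply; rewrite -ltrBlDl sub0r.
  apply: le_lt_trans (archi_boundP (normr_ge0 (- x))); exact: ler_norm.
move=> n; elim: n x => [x|n IH x].
  rewrite addr0 => x0; apply: nondecreasing_is_cvgn.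
    exact: nondecreasing_series_trigamma.
  exists (x ^- 2 + x^-1) => _ [N _ <-].
  apply: (le_trans (nondecreasing_series_trigamma x (leqnSn N))).
  rewrite series_trigammaS lerD2l (le_trans (series_trigamma_le N x0))//.
  by rewrite gerBl invr_ge0 ltW// ltr_wpDr.
rewrite -natr1 [n%:R + 1]addrC addrA => /IH cv.
apply/cvg_ex; exists (x ^- 2 + limn (series (trigamma_term (x + 1)))).
rewrite -cvg_shiftS (funext (series_trigammaS x)).
by apply: cvgD => //; exact: cvg_cst.
Qed.

Arguments cvg_trigamma x : clear implicits.

Lemma trigammaS x : trigamma x = x ^- 2 + trigamma (x + 1).
Proof.
have := cvg_trigamma x; rewrite -cvg_shiftS => cv; apply: (cvg_unique _ cv) => //.
rewrite (funext (series_trigammaS x)).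
by apply: cvgD; [exact: cvg_cst|exact: cvg_trigamma].
Qed.

Lemma trigamma_ge0 x : 0 <= trigamma x.
Proof.
apply: limr_ge; first by apply: cvgP; exact: cvg_trigamma.
by apply: nearW => N; apply: sumr_ge0 => k _; exact: trigamma_term_ge0.
Qed.

Lemma cvg_inv_addn x : ((x + N%:R)^-1 @[N --> \oo] --> (0 : R)).
Proof.
apply/gtr0_cvgV0.
  near=> N; rewrite -ltrBlDl sub0r; near: N; exact: nbhs_infty_gtr.
apply/cvgryPge => A; near=> N; rewrite -lerBlDl; near: N; exact: nbhs_infty_ger.
Unshelve. all: end_near. Qed.

Lemma trigammaS_le x : 0 < x -> trigamma (x + 1) <= x^-1.
Proof.
move=> x0; rewrite -[leRHS]subr0.
have l : x^-1 - (x + N%:R)^-1 @[N --> \oo] --> x^-1 - 0.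
  by apply: cvgB; [exact: cvg_cst|exact: cvg_inv_addn].
by apply: ler_cvg_to (cvg_trigamma _) l _; apply: nearW => N; exact: series_trigamma_le.
Qed.

Lemma trigamma_ge x : 0 < x -> x^-1 <= trigamma x.
Proof.
move=> x0; rewrite -[leLHS]subr0.
have l : x^-1 - (x + N%:R)^-1 @[N --> \oo] --> x^-1 - 0.
  by apply: cvgB; [exact: cvg_cst|exact: cvg_inv_addn].
by apply: ler_cvg_to l (cvg_trigamma _) _; apply: nearW => N; exact: series_trigamma_ge.
Qed.

(** The terms 4/(x+2k)^2 and 4/(x+2k+1)^2 together run over all 4/(x+j)^2. *)
Lemma trigamma_dup x :
  trigamma (x / 2) + trigamma ((x + 1) / 2) = 4 * trigamma x.
Proof.
have e N : series (trigamma_term (x / 2)) N + series (trigamma_term ((x + 1) / 2)) N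
   = 4 * series (trigamma_term x) (N.*2).
  elim: N => [|N IH]; first by rewrite /series /= !big_geq// addr0 mulr0.
  rewrite doubleS !seriesSr addrACA IH -addrA !mulrDr; congr (_ + _).
  have scale (y : R) : (y / 2) ^- 2 = 4 * y ^- 2.
    by rewrite expr_div_n invfM invrK mulrC -natrX.
  rewrite /trigamma_term -!scale; congr (_ ^- 2 + _ ^- 2);
    by rewrite -?natr1 -mul2n natrM; field.
transitivity (limn (fun N => 4 * series (trigamma_term x) N.*2)).
  rewrite -(funext e); apply/esym/cvg_lim => //.
  by apply: cvgD; exact: cvg_trigamma.
apply/cvg_lim => //.
apply: cvgMr; apply: (cvg_comp _ _ _ (cvg_trigamma x)).
apply/cvgnyPge => A; near=> N; rewrite -addnn (leq_trans _ (leq_addr _ _))//.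
near: N; exact: nbhs_infty_ge.
Unshelve. all: end_near. Qed.

End Trigamma.

(** * The partial fraction expansion of 1/sin^2 *)

Section SineBounds.
Variable R : realType.
Implicit Types x y : R.

Lemma normr_sin_le x : `|sin x| <= `|x|.
Proof.
wlog x0 : x / 0 <= x => [H|].
  have [/H//|/ltW x0] := leP 0 x.
  by rewrite -normrN -sinN -[leRHS]normrN; apply: H; rewrite oppr_ge0.
have [c _] := MVT_segment x0 (fun y _ => is_derive_sin y)
  (continuous_subspaceT (@continuous_sin R)).
by rewrite sin0 !subr0 => ->; rewrite normrM ler_piMl// cos_max.
Qed.

Lemma mul_cos_le_sin y : 0 <= y <= pi / 2 -> y * cos y <= sin y.
Proof.
move=> /andP[y0 ypi].
pose f (t : R) := sin t - t * cos t.
have df (t : R) : is_derive t 1 f (t * sin t).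
  by apply: is_derive_eq; rewrite /GRing.scale /=; ring.
have cf : {within `[0, y], continuous f}.
  apply: derivable_within_continuous => t _; exact: ex_derive.
have [c /[!in_itv]/= /andP[c0 cy]] := MVT_segment y0 (fun t _ => df t) cf.
rewrite /f sin0 mul0r !subr0 -subr_ge0 => ->.
rewrite !mulr_ge0// sin_ge0_pi// c0 (le_trans cy)//.
by apply: (le_trans ypi); have := pi_gt0 R; lra.
Qed.

End SineBounds.

Section PeriodicInt.
Variables (R : realType) (T : Type).

Lemma periodic_int (f : R -> T) : (forall x, f (x + 1) = f x) ->
  forall x (m : int), f (x + m%:~R) = f x.
Proof.
move=> f1 x; have pos n y : f (y + n%:R) = f y.
  by elim: n => [|n IH]; rewrite ?addr0// -natr1 addrA f1.
case=> n; first exact: pos.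
by rewrite NegzE mulrNz -pmulrn -(pos n.+1 (x - _)) subrK.
Qed.

Lemma periodic_int_cst (f : R -> T) (c : T) : (forall x, f (x + 1) = f x) ->
  (forall x, 0 < x < 1 -> f x = c) -> forall x, x \isn't a Num.int -> f x = c.
Proof.
move=> f1 fc x xint.
rewrite -(fc (x - (Num.floor x)%:~R)); first by rewrite -mulrNz periodic_int.
rewrite subr_gt0 ltrBlDl -intrD1 floorD1_gt andbT lt_neqAle floor_le_tmp andbT.
by apply: contraNneq xint => <-; exact: intr_int.
Qed.

End PeriodicInt.

Section Partition.
Variable R : realType.
Implicit Types x : R.

Definition sinsq x : R := (sin (pi * x) / pi) ^+ 2.

Lemma sinsq_ge0 x : 0 <= sinsq x.
Proof. exact: sqr_ge0. Qed.

Lemma sinsqD1 x : sinsq (x + 1) = sinsq x.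
Proof. by rewrite /sinsq mulrDr mulr1 sinDpi mulNr sqrrN. Qed.

Lemma sinsqN x : sinsq (- x) = sinsq x.
Proof. by rewrite /sinsq mulrN sinN mulNr sqrrN. Qed.

Lemma sinsq_onem x : sinsq (1 - x) = sinsq x.
Proof. by rewrite -sinsqN opprB -sinsqD1 subrK. Qed.

Lemma sinsq_gt0 x : 0 < x < 1 -> 0 < sinsq x.
Proof.
move=> /andP[x0 x1]; rewrite exprn_gt0// divr_gt0 ?pi_gt0// sin_gt0_pi//.
by rewrite mulr_gt0 ?pi_gt0//= gtr_pMr ?pi_gt0.
Qed.

(** With y = pi x/2: 1/sin^2 y + 1/cos^2 y = 1/(sin y cos y)^2 = 4/sin^2(2y). *)
Lemma sinsq_dup x : sinsq x != 0 ->
  (sinsq (x / 2))^-1 + (sinsq ((x + 1) / 2))^-1 = 4 / sinsq x.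
Proof.
have p0 := lt0r_neq0 (pi_gt0 R).
set y := pi * (x / 2).
have e1 : pi * ((x + 1) / 2) = y + pi / 2 by rewrite /y; ring.
have e2 : pi * x = y *+ 2 by rewrite /y; field.
rewrite /sinsq e1 e2 sinDpihalf sin_mulr2n -/y.
rewrite -mulr_natr sqrf_eq0 !mulf_eq0 !negb_or => /andP[/andP[/andP[c0 s0] _] _].
have -> : 4 / (cos y * sin y * 2 / pi) ^+ 2 =
    (cos y ^+ 2 + sin y ^+ 2) * (pi / (cos y * sin y)) ^+ 2.
  by rewrite cos2Dsin2; move: pi p0 => p p0; field; rewrite c0 s0 p0.
by move: pi p0 => p p0; field; rewrite ?c0 ?s0 ?p0.
Qed.

(** The defect of the expansion. Both of its terms obey the same duplication
    formula, and their poles at 0 and 1 cancel. *)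
Definition trigamma_gap x : R := (sinsq x)^-1 - (trigamma x + trigamma (1 - x)).

Lemma trigamma_gap_dup x : 0 < x < 1 ->
  trigamma_gap (x / 2) + trigamma_gap ((x + 1) / 2) = 4 * trigamma_gap x.
Proof.
move=> x01.
rewrite /trigamma_gap mulrBr -sinsq_dup ?lt0r_neq0 ?sinsq_gt0//.
rewrite mulrDr -!trigamma_dup.
have -> : 1 - x / 2 = (1 - x + 1) / 2 by field.
have -> : 1 - (x + 1) / 2 = (1 - x) / 2 by field.
by ring.
Qed.

Lemma trigamma_gapC x : trigamma_gap (1 - x) = trigamma_gap x.
Proof.
rewrite /trigamma_gap subKr [trigamma _ + _]addrC; congr (_^-1 - _).
exact: sinsq_onem.
Qed.

(** By the symmetry x -> 1-x only the pole at 0 matters, and it cancels: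
    sin y <= y and y cos y <= sin y give 0 <= 1/sin^2 y - 1/y^2 <= 1. *)
Lemma trigamma_gap_bounded x : 0 < x < 1 -> `|trigamma_gap x| <= pi ^+ 2 + 8.
Proof.
wlog x2 : x / x <= 2^-1 => [H x01|/andP[x0 x1]].
  have [/H->//|x2] := leP x 2^-1.
  by rewrite -trigamma_gapC H//; lra.
have p0 := pi_gt0 R.
have A1 : trigamma (1 - x) <= 6.
  rewrite trigammaS (_ : 6 = 4 + 2); last by ring.
  have h : 2^-1 <= 1 - x by lra.
  rewrite lerD//.
    rewrite -[4]invrK lef_pV2 ?posrE ?exprn_gt0//; nra.
  rewrite (le_trans (trigammaS_le _))//; first lra.
  by rewrite -[leRHS]invrK lef_pV2 ?posrE//; lra.
have A2 := trigamma_ge0 (1 - x).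
have B1 : trigamma (x + 1) <= 2.
  rewrite trigammaS (_ : 2 = 1 + 1); last by ring.
  rewrite lerD//; last rewrite (le_trans (trigammaS_le _))//; last 2 first.
  - by lra.
  - by rewrite invf_le1; lra.
  by rewrite invf_le1 ?exprn_gt0//; nra.
have B2 := trigamma_ge0 (x + 1).
have C1 : x ^- 2 <= (sinsq x)^-1.
  rewrite lef_pV2 ?posrE ?sinsq_gt0 ?x0 ?x1 ?exprn_gt0//.
  rewrite ler_sqr ?nnegrE ?(ltW x0)//; last first.
    rewrite divr_ge0 ?(ltW p0)// sin_ge0_pi//.
    by rewrite mulr_ge0 ?(ltW p0) ?(ltW x0)// ler_piMr ?(ltW p0) ?(ltW x1).
  rewrite ler_pdivrMr// mulrC.
  apply: le_trans (ler_norm _) (le_trans (normr_sin_le _) _).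
  by rewrite ger0_norm ?mulr_ge0 ?(ltW p0) ?(ltW x0).
have C2 : (sinsq x)^-1 <= x ^- 2 + pi ^+ 2.
  have h : pi * x * cos (pi * x) <= sin (pi * x).
    apply: mul_cos_le_sin; rewrite mulr_ge0 ?(ltW p0) ?(ltW x0)//.
    by rewrite ler_pM2l.
  have s0 : 0 < sin (pi * x) by rewrite sin_gt0_pi// mulr_gt0//= gtr_pMr.
  have c0 : 0 <= cos (pi * x).
    apply: cos_ge0_pihalf; rewrite ler_pM2l// x2 andbT.
    by rewrite (@le_trans _ _ 0) ?mulr_ge0 ?ltW//; lra.
  have h2 : (pi * x * cos (pi * x)) ^+ 2 <= sin (pi * x) ^+ 2.
    by rewrite ler_sqr// nnegrE ?mulr_ge0 ?(ltW p0) ?(ltW x0) ?(ltW s0).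
  rewrite /sinsq expr_div_n invf_div ler_pdivrMr ?exprn_gt0//.
  rewrite -(ler_pM2l (exprn_gt0 2 x0)).
  have -> : x ^+ 2 * ((x ^- 2 + pi ^+ 2) * sin (pi * x) ^+ 2) =
    sin (pi * x) ^+ 2 + (x * pi) ^+ 2 * sin (pi * x) ^+ 2 by field; lra.
  have -> : x ^+ 2 * pi ^+ 2 =
    (pi * x * cos (pi * x)) ^+ 2 + (x * pi) ^+ 2 * sin (pi * x) ^+ 2.
    by rewrite sin2cos2; ring.
  by rewrite lerD2r.
have D := sqr_ge0 (pi : R).
by rewrite /trigamma_gap (trigammaS x) ler_norml; lra.
Qed.

(** Herglotz's trick: a bound B for the gap g on (0,1) improves to B/2, because
    4 g(x) = g(x/2) + g((x+1)/2); hence g = 0. Both sides have period 1. *)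
Lemma sinsq_trigamma x : x \isn't a Num.int ->
  sinsq x * (trigamma x + trigamma (1 - x)) = 1.
Proof.
move=> xint; pose f y := sinsq y * (trigamma y + trigamma (1 - y)).
apply: (@periodic_int_cst _ _ f 1 _ _ x xint) => {xint}x; rewrite /f {f};
  last move=> x01.
  rewrite sinsqD1 (trigammaS x) opprD addrCA subrr addr0 addrAC (trigammaS (- x)).
  by rewrite sqrrN [- x + 1]addrC; ring.
suff : `|trigamma_gap x| <= 0.
  rewrite normr_le0 subr_eq0 => /eqP <-.
  by rewrite mulfV// lt0r_neq0// sinsq_gt0.
suff iter n y : 0 < y < 1 -> `|trigamma_gap y| <= (pi ^+ 2 + 8) * 2^-1 ^+ n.
  have l : (pi ^+ 2 + 8) * (2^-1 : R) ^+ n @[n --> \oo] --> (pi ^+ 2 + 8) * 0.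
    by apply: cvgMl_tmp; apply: cvg_expr; rewrite ger0_norm; lra.
  rewrite -(mulr0 (pi ^+ 2 + 8)).
  apply: ler_cvg_to (cvg_cst _) l _; apply: nearW => n; exact: iter.
elim: n y => [|n IH] y y01; first by rewrite expr0 mulr1 trigamma_gap_bounded.
have := trigamma_gap_dup y01.
have h1 : 0 < y / 2 < 1 by lra.
have h2 : 0 < (y + 1) / 2 < 1 by lra.
have := IH _ h1; have := IH _ h2.
rewrite (exprSr _ n) mulrA; set B := _ * 2^-1 ^+ n; clearbody B.
rewrite !ler_norml => /andP[? ?] /andP[? ?] e; apply/andP; split; lra.
Qed.

End Partition.

(** * The functions H_0 and H^+- away from the integers *)

(** Its value at 0 is 0 and not 1, as 0^-1 is 0; no integral sees this. *)
Local Notation fejer := H1_formula.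

Section FejerKernel.
Variable R : realType.
Implicit Types x t : R.

Lemma fejerE x : fejer x = sinsq x / x ^+ 2.
Proof. by rewrite /H1_formula /sinsq invfM mulrA expr_div_n. Qed.

Lemma fejer_ge0 x : 0 <= fejer x.
Proof. exact: sqr_ge0. Qed.

Lemma fejer0 : fejer (0 : R) = 0.
Proof. by rewrite fejerE expr0n/= invr0 mulr0. Qed.

Lemma fejerN x : fejer (- x) = fejer x.
Proof. by rewrite !fejerE sinsqN sqrrN. Qed.

Lemma fejer_le1 x : fejer x <= 1.
Proof.
have [->|x0] := eqVneq x 0; first by rewrite fejer0.
have p0 : 0 < `|pi * x| by rewrite normr_gt0 mulf_neq0// lt0r_neq0// pi_gt0.
rewrite /H1_formula -real_normK ?num_real// expr_le1// normrM normfV.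
by rewrite ler_pdivrMr// mul1r normr_sin_le.
Qed.

Lemma cvg_series_fejer x :
  series (fun k => fejer (x + k%:R)) @ \oo --> sinsq x * trigamma x.
Proof.
rewrite (_ : series _ = fun N => sinsq x * series (trigamma_term x) N).
  by apply: cvgMl_tmp; exact: cvg_trigamma.
apply/funext => N; rewrite /series /= mulr_sumr; apply: eq_bigr => k _.
by rewrite fejerE (periodic_int (@sinsqD1 R) x k).
Qed.

Lemma H0_formulaE x : H0_formula x =
  sinsq x * (trigamma (1 - x) - trigamma (1 + x) + 2 / x).
Proof.
rewrite /H0_formula -/(sinsq x); congr (_ * (_ + _)); congr (_ + _).
  apply/cvg_lim => //; rewrite -cvg_shiftS.
  rewrite (_ : [sequence _]_n = series (trigamma_term (1 - x))).
    exact: cvg_trigamma.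
  apply/funext => N /=; rewrite big_nat_recl// mul0r add0r.
  apply: eq_bigr => k _; rewrite /trigamma_term mul1r -sqrrN; congr (_ ^- 2).
  by rewrite -pmulrn -natr1; ring.
apply/cvg_lim => //.
rewrite (_ : (fun _ => _) = \- series (trigamma_term (1 + x))).
  by apply: cvgN; exact: cvg_trigamma.
apply/funext => N /=; rewrite -sumrN.
apply: eq_bigr => k _; rewrite /trigamma_term mulN1r; congr (- (_ ^- 2)).
by rewrite NegzE mulrNz opprK -pmulrn -natr1; ring.
Qed.

Lemma H0_formula_odd x : H0_formula (- x) = - H0_formula x.
Proof. by rewrite !H0_formulaE sinsqN opprK invrN; ring. Qed.

Lemma H0_formula_eq x : x \isn't a Num.int ->
  H0_formula x = 1 + 2 * (sinsq x / x) - fejer x - 2 * (sinsq x * trigamma (x + 1)).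
Proof.
move=> xint; have e := sinsq_trigamma xint.
rewrite -[X in X + _ - _ - _]e H0_formulaE (trigammaS x) fejerE [1 + x]addrC.
by ring.
Qed.

Lemma Hpm_eq s x : x \isn't a Num.int ->
  Hpm s x = 1 + 2 * (sinsq x / x) - (1 - (-1) ^+ s) * fejer x
    - 2 * (sinsq x * trigamma (x + 1)).
Proof.
move=> xint; have x0 : x != 0 by apply: contraNneq xint => ->; rewrite rpred0.
rewrite /Hpm /H0 /H1 (negbTE xint) (negbTE x0) H0_formula_eq//.
by ring.
Qed.

(** Beurling's inequality. By oddness x > 0 may be assumed, and there
    H_0 - 1 = S(x) (2/x - 1/x^2 - 2 psi(x+1)) with 1/x - 1/x^2 <= psi(x+1) <= 1/x. *)
Lemma normr_H0_formula_sgr x : x \isn't a Num.int ->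
  `|H0_formula x - Num.sg x| <= fejer x.
Proof.
wlog x0 : x / 0 <= x => [H xint|xint].
  have [/H->//|x0] := leP 0 x.
  rewrite -normrN opprD -H0_formula_odd -sgrN -fejerN H ?rpredN//.
  by rewrite oppr_ge0 ltW.
have {}x0 : 0 < x.
  by rewrite lt_neqAle x0 andbT; apply: contraNneq xint => <-; rewrite rpred0.
rewrite gtr0_sg// H0_formula_eq// fejerE.
have -> : 1 + 2 * (sinsq x / x) - sinsq x / x ^+ 2 - 2 * (sinsq x * trigamma (x + 1)) - 1
 = sinsq x * (2 / x - x ^- 2 - 2 * trigamma (x + 1)) by ring.
rewrite normrM ger0_norm ?sinsq_ge0// ler_wpM2l ?sinsq_ge0//.
have := trigammaS_le x0; have := trigamma_ge x0; rewrite (trigammaS x) => ? ?.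
by rewrite ler_norml; lra.
Qed.

End FejerKernel.

(** * Affine changes of variables on the line *)

Section ChangeOfVariables.
Variable R : realType.
Local Notation mu := (@lebesgue_measure R).
Local Open Scope ereal_scope.
Implicit Types (f : R -> \bar R) (a t : R).

Let affine a t : R -> measurableTypeR R := fun x => (a * x + t)%R.

Let measurable_affine a t : measurable_fun [set: measurableTypeR R] (affine a t).
Proof. by apply: measurable_funD => //; apply: measurable_funM. Qed.

(** A measure is Lebesgue measure as soon as it agrees with it on the intervals
    ]x, y]; the image of Lebesgue measure, rescaled by the slope, does. *)
Let pushforward_affine (k : {nonneg R}) t A : (0 < k%:num)%R -> measurable A ->
  mu A = k%:num%:E * mu (affine k%:num t @^-1` A).
Proof.
move=> k0 mA.
pose nu := measure_function_pushforward__canonical__measure_function_Measure mu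
  (measurable_affine k%:num t).
have := @lebesgue_measure_unique R (mscale k nu); apply => // _ [[x y]] _ <-.
rewrite -[RHS]/(k%:num%:E * mu (affine k%:num t @^-1` `]x, y])).
have -> : affine k%:num t @^-1` `]x, y] =
    `]((x - t) / k%:num)%R, ((y - t) / k%:num)%R]%classic.
  apply/seteqP; split => z /=; rewrite !in_itv/= /affine ltr_pdivrMr// ler_pdivlMr//;
  by rewrite ltrBlDr lerBrDr mulrC.
rewrite !lebesgue_measure_itv/= !lte_fin ltr_pM2r ?invr_gt0// ltrD2r.
case: ifPn => _; last by rewrite mule0.
by rewrite -!EFinD -EFinM; congr EFin; field; exact: lt0r_neq0.
Qed.

Lemma ge0_integral_affine a t f : (0 < a)%R -> measurable_fun [set: R] f ->
  (forall x, 0 <= f x) ->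
  a%:E * \int[mu]_x f (a * x + t)%R = \int[mu]_x f x.
Proof.
move=> a0 mf f0; have a0' := ltW a0.
rewrite [RHS](eq_measure_integral (mscale (NngNum a0') (pushforward mu (affine a t)))).
  rewrite ge0_integral_mscale//=.
  by rewrite ge0_integral_pushforward//= preimage_setT.
by move=> A mA _ /=; rewrite (@pushforward_affine (NngNum a0') t).
Qed.

Let integral_comp_invariant (h : R -> R) f :
  (forall g : R -> \bar R, measurable_fun [set: R] g -> (forall x, 0 <= g x) ->
    \int[mu]_x g (h x) = \int[mu]_x g x) ->
  measurable_fun [set: R] f -> \int[mu]_x f (h x) = \int[mu]_x f x.
Proof.
move=> hinv mf; rewrite integralE [RHS]integralE.
rewrite -(hinv _ (measurable_funepos mf) (funepos_ge0 f)).
rewrite -(hinv _ (measurable_funeneg mf) (funeneg_ge0 f)).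
by rewrite -[fun x => f (h x)]/(f \o h) funepos_comp funeneg_comp.
Qed.

Lemma integral_shift t f : measurable_fun [set: R] f ->
  \int[mu]_x f (x + t)%R = \int[mu]_x f x.
Proof.
apply: integral_comp_invariant => g mg g0.
rewrite -(ge0_integral_affine t ltr01 mg g0) mul1e.
by apply: eq_integral => x _; rewrite mul1r.
Qed.

Lemma integral_opp f : measurable_fun [set: R] f ->
  \int[mu]_x f (- x)%R = \int[mu]_x f x.
Proof.
apply: integral_comp_invariant => g mg g0.
rewrite [RHS](eq_measure_integral (pushforward mu (-%R : _ -> measurableTypeR R))).
  by rewrite ge0_integral_pushforward//= preimage_setT.
by move=> A mA _; exact/esym/lebesgue_measureN.
Qed.

Lemma integrable_shift t f :
  mu.-integrable [set: R] f -> mu.-integrable [set: R] (fun x => f (x + t)%R).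
Proof.
move=> /integrableP[mf fi]; apply/integrableP; split.
  by apply: (measurableT_comp mf); exact: measurable_funD.
by rewrite (integral_shift t (measurableT_comp (@abse_measurable R _) mf)).
Qed.

Lemma integrable_opp f :
  mu.-integrable [set: R] f -> mu.-integrable [set: R] (fun x => f (- x)%R).
Proof.
move=> /integrableP[mf fi]; apply/integrableP; split.
  by apply: (measurableT_comp mf); exact: oppr_measurable.
by rewrite (integral_opp (measurableT_comp (@abse_measurable R _) mf)).
Qed.

End ChangeOfVariables.

Section RealChangeOfVariables.
Variable R : realType.
Local Notation mu := (@lebesgue_measure R).
Implicit Types t : R.

Lemma Rintegral_opp (f : R -> R) : measurable_fun [set: R] f ->
  \int[mu]_x f (- x) = \int[mu]_x f x.
Proof.
by move=> mf; congr fine; apply: (integral_opp (f := EFin \o f)); exact/measurable_EFinP.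
Qed.

Lemma Rintegral_shift t (f : R -> R) : measurable_fun [set: R] f ->
  \int[mu]_x f (x + t) = \int[mu]_x f x.
Proof.
by move=> mf; congr fine; apply: (integral_shift t (f := EFin \o f)); exact/measurable_EFinP.
Qed.

Lemma Rintegral_odd (f : R -> R) : mu.-integrable [set: R] (EFin \o f) ->
  (forall x, f (- x) = - f x) -> \int[mu]_x f x = 0.
Proof.
move=> fi fodd; have : \int[mu]_x f (- x) = \int[mu]_x f x.
  by congr fine; apply: (integral_opp (f := EFin \o f)); exact: measurable_int fi.
have -> : \int[mu]_x f (- x) = -1 * \int[mu]_x f x.
  by rewrite -RintegralZl//; apply: eq_Rintegral => x _; rewrite fodd mulN1r.
by move/eqP; rewrite mulN1r -subr_eq0 -opprD oppr_eq0 -mulr2n mulrn_eq0 => /eqP.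
Qed.

End RealChangeOfVariables.

(** * Measurability and modification on countable sets *)

Section Measurability.
Variable R : realType.

Lemma countable_measurable (A : set R) : countable A -> measurable A.
Proof.
move=> /pfcard_geP [->|[f]]; first exact: measurable0.
have -> : A = \bigcup_n [set f n].
  rewrite bigcup_imset1; apply/seteqP; split => [x /(@surj _ _ _ _ f) [n _ <-]|].
    by exists n.
  by move=> _ [n _ <-]; exact: funS.
by apply: bigcupT_measurable => n; exact: measurable_set1.
Qed.

Lemma measurable_fun_eq_off_countable (N : set R) (f g : R -> R) :
  countable N -> (forall x, ~ N x -> f x = g x) ->
  measurable_fun [set: R] g -> measurable_fun [set: R] f.
Proof.
move=> cN fg mg; have mN := countable_measurable cN.
rewrite -(setvU N); apply/measurable_funU => //; first exact: measurableC.
split.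
  apply: (eq_measurable_fun g); first by move=> x /[!inE] /fg.
  exact: measurable_funS mg.
move=> _ Y _; apply: countable_measurable.
by apply: sub_countable cN; exact: subset_card_le.
Qed.

Lemma measurable_inv : measurable_fun [set: R] (@GRing.inv R).
Proof.
rewrite -(setvU [set 0]); apply/measurable_funU => //; first exact: measurableC.
split; last by exact: measurable_fun_set1.
apply: open_continuous_measurable_fun; first exact: closed_openC.
by move=> x; rewrite inE /= => /eqP x0; exact: inv_continuous.
Qed.

Lemma measurable_sin : measurable_fun [set: R] (@sin R).
Proof. by apply: continuous_measurable_fun; exact: continuous_sin. Qed.

Lemma measurable_cos : measurable_fun [set: R] (@cos R).
Proof. by apply: continuous_measurable_fun; exact: continuous_cos. Qed.

Lemma measurable_sinsq : measurable_fun [set: R] (@sinsq R).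
Proof.
apply: measurable_funX; apply: measurable_funM => //.
by apply: (measurableT_comp measurable_sin); exact: mulrl_measurable.
Qed.

Lemma measurable_fejer : measurable_fun [set: R] (@H1_formula R).
Proof.
rewrite (_ : @H1_formula R = fun x => sinsq x * (x ^+ 2)^-1).
  apply: measurable_funM; first exact: measurable_sinsq.
  by apply: (measurableT_comp measurable_inv); exact: exprn_measurable.
by apply/funext => x; rewrite fejerE.
Qed.

End Measurability.

Section EqOffCountable.
Variable R : realType.
Local Notation mu := (@lebesgue_measure R).

Lemma countable_int (f g : R -> R) : cancel f g ->
  countable [set x | f x \is a Num.int].
Proof.
move=> fK; apply: (@sub_countable _ _ _ (range (fun m : int => g m%:~R))).
  apply: subset_card_le => x /= /intrP[m fm]; exists m => //.
  by rewrite -fm fK.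
by apply: (sub_countable (card_image_le _ _)); exact: countableP.
Qed.

Lemma ae_eq_off_countable (N : set R) (f g : R -> R) : countable N ->
  (forall x, ~ N x -> f x = g x) ->
  ae_eq mu [set: R] (EFin \o f) (EFin \o g).
Proof.
move=> cN fg; exists N; split.
- exact: countable_measurable.
- exact: countable_lebesgue_measure0.
- by move=> x /= h; apply: contrapT => /fg fgx; apply: h => _; rewrite fgx.
Qed.

Lemma Rintegral_eq_off_countable (N : set R) (f g : R -> R) : countable N ->
  (forall x, ~ N x -> f x = g x) -> measurable_fun [set: R] g ->
  \int[mu]_x f x = \int[mu]_x g x.
Proof.
move=> cN fg mg; congr fine; apply: ae_eq_integral => //.
- by apply/measurable_EFinP; exact: measurable_fun_eq_off_countable cN fg mg.
- exact/measurable_EFinP.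
- exact: ae_eq_off_countable cN fg.
Qed.

End EqOffCountable.

(** * The total mass of the Fejer kernel *)

Section FejerIntegral.
Variable R : realType.
Local Notation mu := (@lebesgue_measure R).

Lemma measurable_sinsq_trigamma :
  measurable_fun [set: R] (fun x => sinsq x * trigamma x).
Proof.
have h := @measurable_fun_cvg _ _ R [set: R]
  (fun n x => series (fun k => fejer (x + k%:R)) n).
apply: h => [|x _]; last exact: cvg_series_fejer.
  move=> n; apply: measurable_sum => k.
  by apply: (measurableT_comp (@measurable_fejer R)); exact: measurable_funD.
Qed.

Local Open Scope ereal_scope.

Lemma nneseries_EFin (u : nat -> R) l :
  series u @ \oo --> l -> \sum_(0 <= k <oo) (u k)%:E = l%:E.
Proof.
move=> ul; apply/cvg_lim => //; under eq_fun do rewrite sumEFin.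
by apply: cvg_EFin => //; exact: nearW.
Qed.

Let cell (z : R) : set R := `[z, (z + 1)%R[%classic.

Let measurable_cell z : measurable (cell z).
Proof. exact: measurable_itv. Qed.

Let integral_cell (f : R -> \bar R) z : measurable_fun [set: R] f ->
  \int[mu]_(x in cell z) f x = \int[mu]_(x in `[0%R, 1%R[) f (x + z)%R.
Proof.
move=> mf; rewrite integral_mkcond [RHS]integral_mkcond.
rewrite -(integral_shift z); last first.
  apply/measurable_restrict; [exact: measurable_cell|exact: measurableT|].
  exact: measurable_funTS.
apply: eq_integral => x _; rewrite !patchE; congr (if _ then _ else _).
by apply/idP/idP; rewrite !inE /cell/= !in_itv/=; lra.
Qed.

(** The line is cut into the cells [m, m+1[, and each cell is translated back to
    [0, 1[; the two sums are the cells with m >= 0 and those with m < 0. *)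
Lemma ge0_integral_periodize (f : R -> \bar R) :
  measurable_fun [set: R] f -> (forall x, 0 <= f x) ->
  \int[mu]_x f x =
    \int[mu]_(x in `[0%R, 1%R[) (\sum_(0 <= k <oo) f (x + k%:R)%R) +
    \int[mu]_(x in `[0%R, 1%R[) (\sum_(0 <= k <oo) f (x - k.+1%:R)%R).
Proof.
move=> mf f0.
have piece (h : nat -> R) : trivIset [set: nat] (cell \o h) ->
    \int[mu]_(x in \bigcup_k cell (h k)) f x =
    \int[mu]_(x in `[0%R, 1%R[) (\sum_(0 <= k <oo) f (x + h k)%R).
  move=> tF; rewrite ge0_integral_bigcup//; last 2 first.
  - by move=> k; exact: measurable_cell.
  - exact: measurable_funTS.
  rewrite integral_nneseries//.
    by apply: eq_eseriesr => k _; exact: integral_cell.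
  by move=> k; apply: measurable_funTS; apply: (measurableT_comp mf); exact: measurable_funD.
have cellP (x y z : R) : cell y x -> cell z x -> (`|y - z| < 1)%R.
  by rewrite /cell /= !in_itv/= ltr_norml; lra.
have natP (i j : nat) : (`|i%:R - j%:R : R| < 1)%R -> i = j.
  by rewrite !pmulrn -intrB -intr_norm -[1%R]/(1%:~R) ltr_int; lia.
rewrite -(piece (fun k => k%:R)%R); last first.
  by move=> i j _ _ [x [/cellP ci /ci]]; exact: natP.
rewrite -(piece (fun k => - k.+1%:R)%R); last first.
  by move=> i j _ _ [x [/cellP ci /ci]] /=; rewrite -opprD normrN => /natP [].
rewrite -ge0_integral_setU//.
- congr integral; apply/seteqP; split => // x _.
  have : cell (Num.floor x)%:~R x.
    by rewrite /cell/= in_itv/= floor_le_tmp -intrD1 floorD1_gt.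
  by case: (Num.floor x) => n; [left|right]; exists n.
- by apply: bigcupT_measurable => k; exact: measurable_itv.
- by apply: bigcupT_measurable => k; exact: measurable_itv.
- exact: measurable_funTS.
- apply/disj_setPS => x [[i _] + [j _]].
  rewrite /cell /= !in_itv/= => /andP[xi _] /andP[_ xj].
  have : (0 <= i%:R :> R)%R by []. have : (0 <= j%:R :> R)%R by [].
  move: xj; rewrite -natr1; lra.
Qed.

Lemma integral_fejer : \int[mu]_x (fejer x)%:E = 1.
Proof.
rewrite ge0_integral_periodize; last 2 first.
- apply/measurable_EFinP. exact: measurable_fejer.
- by move=> x; rewrite lee_fin fejer_ge0.
under eq_integral do rewrite (nneseries_EFin (@cvg_series_fejer R _)).
have e (x : R) : \sum_(0 <= k <oo) (fejer (x - k.+1%:R))%:E =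
    (sinsq x * trigamma (1 - x))%:E.
  rewrite -(sinsq_onem x).
  rewrite -(nneseries_EFin (@cvg_series_fejer R (1 - x)%R)).
  apply: eq_eseriesr => k _; congr EFin; rewrite -fejerN; congr fejer.
  by rewrite -natr1; ring.
under [X in _ + X]eq_integral do rewrite e.
have mA : measurable_fun [set: R] (fun x => (sinsq x * trigamma x)%:E).
  by apply/measurable_EFinP; exact: measurable_sinsq_trigamma.
have mB : measurable_fun [set: R] (fun x => (sinsq x * trigamma (1 - x))%:E).
  rewrite (_ : (fun _ => _) =
      (fun y => (sinsq y * trigamma y)%:E) \o (fun x => 1 - x)%R).
    by apply: (measurableT_comp mA); exact: measurable_funB.
  by apply/funext => x /=; rewrite sinsq_onem.
rewrite -ge0_integralD//; last 4 first.
- by move=> x _; rewrite lee_fin mulr_ge0 ?sinsq_ge0 ?trigamma_ge0.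
- exact: measurable_funTS.
- by move=> x _; rewrite lee_fin mulr_ge0 ?sinsq_ge0 ?trigamma_ge0.
- exact: measurable_funTS.
rewrite -integral_itv_obnd_cbnd; last by apply: measurable_funTS; exact: emeasurable_funD.
transitivity (\int[mu]_(x in `]0%R, 1%R[) (1%:E)).
  apply: eq_integral => x; rewrite inE/= in_itv/= => x01.
  rewrite -EFinD -mulrDr sinsq_trigamma//.
  by apply/negP => /intrP[m xm]; move: x01; rewrite xm ltr0z ltrz1; lia.
rewrite integral_cst//= lebesgue_measure_itv/= lte_fin ltr01 mul1e.
by rewrite oppr0 adde0.
Qed.

End FejerIntegral.

(** * The Fourier transform of the Fejer kernel *)

Section FejerFourier.
Variable R : realType.
Local Notation mu := (@lebesgue_measure R).
Implicit Types (x t xi : R).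

Lemma measurable_affine (a c : R) : measurable_fun [set: R] (fun x => a * x + c).
Proof. by apply: measurable_funD => //; exact: mulrl_measurable. Qed.

Lemma measurable_cos_affine (a c : R) :
  measurable_fun [set: R] (fun x => cos (a * x + c)).
Proof.
apply: (measurableT_comp (@measurable_cos R)).
exact: measurable_affine.
Qed.

Lemma integrable_fejer : mu.-integrable [set: R] (EFin \o @H1_formula R).
Proof.
apply/integrableP; split; first by apply/measurable_EFinP; exact: measurable_fejer.
under eq_integral do rewrite /= ger0_norm ?fejer_ge0//.
by rewrite integral_fejer ltry.
Qed.

Lemma Rintegral_fejer : \int[mu]_x fejer x = 1.
Proof. by rewrite /Rintegral integral_fejer. Qed.

Lemma integrable_fejerM (g : R -> R) (B : R) : measurable_fun [set: R] g ->
  (forall x, `|g x| <= B) ->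
  mu.-integrable [set: R] (EFin \o (fun x => fejer x * g x)).
Proof.
move=> mg gB.
apply: (@le_integrable _ _ _ mu setT measurableT _ (fun x => (fejer x * B)%:E)).
- by apply/measurable_EFinP; apply: measurable_funM => //; exact: measurable_fejer.
- move=> x _ /=; rewrite lee_fin normrM [leRHS]normrM ler_wpM2l//.
  exact: le_trans (gB x) (ler_norm B).
- under eq_fun do rewrite EFinM; apply: integrableZr => //; exact: integrable_fejer.
Qed.

(** This is c^2 K(c x), of mass c for c >= 0. All these functions share the
    denominator x^2, so linear relations between them are trigonometric identities. *)
Definition fejer_scaled (c x : R) : R := sinsq (c * x) / x ^+ 2.

Lemma fejer_scaledE c x : fejer_scaled c x = c ^+ 2 * fejer (c * x).
Proof.
rewrite /fejer_scaled fejerE; have [->|c0] := eqVneq c 0.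
  by rewrite mul0r expr0n/= mul0r /sinsq mulr0 sin0 mul0r expr0n/= mul0r.
have [->|x0] := eqVneq x 0; first by rewrite mulr0 expr0n/= !invr0 !mulr0.
by field; rewrite x0 c0.
Qed.

Lemma integral_fejer_scaled c : 0 <= c ->
  (\int[mu]_x (fejer_scaled c x)%:E = c%:E)%E.
Proof.
rewrite le_eqVlt => /predU1P[<-|c0].
  by under eq_integral do rewrite fejer_scaledE expr0n/= mul0r; rewrite integral0.
have mf : measurable_fun [set: R] (fun x : R => (fejer x)%:E).
  by apply/measurable_EFinP; exact: measurable_fejer.
have f0 x : (0 <= (fejer x)%:E)%E by rewrite lee_fin fejer_ge0.
have := ge0_integral_affine 0 c0 mf f0; rewrite integral_fejer => e.
transitivity (\int[mu]_x (c%:E * (c%:E * (fejer (c * x + 0))%:E)))%E.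
  by apply: eq_integral => x _; rewrite fejer_scaledE addr0 -!EFinM mulrA.
have mg : measurable_fun [set: R] (fun x => (fejer (c * x + 0))%:E).
  exact: (measurableT_comp mf (measurable_affine c 0)).
have c0' := ltW c0.
have f1 x : setT x -> (0 <= c%:E * (fejer (c * x + 0))%:E)%E.
  by rewrite mule_ge0// lee_fin.
have f2 x : setT x -> (0 <= (fejer (c * x + 0))%:E)%E by [].
rewrite (ge0_integralZl_EFin mu measurableT f1 (measurable_funeM c%:E mg) c0').
by rewrite (ge0_integralZl_EFin mu measurableT f2 mg c0') e mule1.
Qed.

Lemma integrable_fejer_scaled c : 0 <= c ->
  mu.-integrable [set: R] (EFin \o fejer_scaled c).
Proof.
move=> c0; apply/integrableP; split.
  apply/measurable_EFinP; rewrite (funext (fejer_scaledE c)).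
  apply: measurable_funM => //; apply: (measurableT_comp (@measurable_fejer R)).
  exact: mulrl_measurable.
under eq_integral do rewrite /= ger0_norm ?divr_ge0 ?sinsq_ge0 ?sqr_ge0//.
by rewrite integral_fejer_scaled// ltry.
Qed.

Lemma Rintegral_fejer_scaled c : 0 <= c -> \int[mu]_x fejer_scaled c x = c.
Proof. by move=> c0; rewrite /Rintegral integral_fejer_scaled. Qed.

(** sin^2 A cos 2B = (sin^2(A+B) + sin^2(A-B))/2 - sin^2 B, which reduces the
    Fourier transform of K to the masses of its dilates. *)
Lemma fejerM_cos x xi : fejer x * cos (2 * pi * x * xi) =
  2^-1 * (fejer_scaled (1 + xi) x + fejer_scaled (1 - xi) x) - fejer_scaled xi x.
Proof.
rewrite fejerE /fejer_scaled.
suff e : sinsq x * cos (2 * pi * x * xi) =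
    2^-1 * (sinsq ((1 + xi) * x) + sinsq ((1 - xi) * x)) - sinsq (xi * x).
  by rewrite mulrAC e; ring.
rewrite /sinsq; set A := pi * x; set B := pi * (xi * x).
have -> : 2 * pi * x * xi = B *+ 2 by rewrite /B; ring.
have -> : pi * ((1 + xi) * x) = A + B by rewrite /A /B; ring.
have -> : pi * ((1 - xi) * x) = A - B by rewrite /A /B; ring.
rewrite cos_mulr2n sinD sinB !expr_div_n.
have -> : sin B ^+ 2 / pi ^+ 2 = sin B ^+ 2 * (cos A ^+ 2 + sin A ^+ 2) / pi ^+ 2.
  by rewrite cos2Dsin2 mulr1.
have -> : cos B ^+ 2 *+ 2 - 1 = cos B ^+ 2 - sin B ^+ 2.
  by rewrite sin2cos2; ring.
by move: pi (pi_gt0 R) => p p0; field; rewrite lt0r_neq0.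
Qed.

(** The sine part of the phase drops out because K is even. The value is
    ((1+xi) + (1-xi))/2 - xi = 1 - xi times cos c. *)
Lemma Rintegral_fejerM_cos xi (c : R) : 0 <= xi <= 1 ->
  \int[mu]_x (fejer x * cos (2 * pi * x * xi + c)) = (1 - xi) * cos c.
Proof.
move=> /andP[xi0 xi1].
have i1 : mu.-integrable [set: R] (EFin \o fejer_scaled (1 + xi)).
  by apply: integrable_fejer_scaled; lra.
have i2 : mu.-integrable [set: R] (EFin \o fejer_scaled (1 - xi)).
  by apply: integrable_fejer_scaled; lra.
have i3 := integrable_fejer_scaled xi0.
have icos : \int[mu]_x (fejer x * cos (2 * pi * x * xi)) = 1 - xi.
  under eq_Rintegral do rewrite fejerM_cos.
  have i12 : mu.-integrable setT
      (EFin \o (fun x => fejer_scaled (1 + xi) x + fejer_scaled (1 - xi) x)).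
    exact: (integrableD measurableT i1 i2).
  rewrite RintegralB//; last first.
    by apply: (integrableZl measurableT 2^-1 i12).
  rewrite RintegralZl// RintegralD// !Rintegral_fejer_scaled//; lra.
have mc (h : R -> R) : measurable_fun [set: R] h ->
    measurable_fun [set: R] (fun x => h (2 * pi * x * xi)).
  move=> mh; have := measurableT_comp mh (measurable_affine (2 * pi * xi) 0).
  by congr measurable_fun; apply/funext => x /=; congr h; ring.
have isin : \int[mu]_x (fejer x * sin (2 * pi * x * xi)) = 0.
  apply: Rintegral_odd.
    apply: (@integrable_fejerM _ 1); first exact: mc (@measurable_sin R).
    by move=> x; exact: sin_max.
  by move=> x; rewrite fejerN mulrN mulNr sinN mulrN.
transitivity (\int[mu]_x (cos c * (fejer x * cos (2 * pi * x * xi))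
   - sin c * (fejer x * sin (2 * pi * x * xi)))).
  by apply: eq_Rintegral => x _; rewrite cosD; ring.
have ic : mu.-integrable setT (EFin \o (fun x => fejer x * cos (2 * pi * x * xi))).
  apply: (@integrable_fejerM _ 1); first exact: mc (@measurable_cos R).
  by move=> x; exact: cos_max.
have isn : mu.-integrable setT (EFin \o (fun x => fejer x * sin (2 * pi * x * xi))).
  apply: (@integrable_fejerM _ 1); first exact: mc (@measurable_sin R).
  by move=> x; exact: sin_max.
rewrite RintegralB//.
- by rewrite !RintegralZl// icos isin; ring.
- exact: (integrableZl measurableT _ ic).
- exact: (integrableZl measurableT _ isn).
Qed.

End FejerFourier.

Section FejerFubini.
Variable R : realType.
Local Notation mu := (@lebesgue_measure R).
Local Notation I01 := `[(0 : R), (1 : R)]%classic.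
Implicit Types (x t xi : R).

Lemma integrable01 (w : R -> R) (B : R) : measurable_fun [set: R] w ->
  (forall xi, I01 xi -> `|w xi| <= B) -> mu.-integrable I01 (EFin \o w).
Proof.
move=> mw wB; apply: measurable_bounded_integrable => //.
- by rewrite /= lebesgue_measure_itv/= lte_fin ltr01 -EFinB ltry.
- exact: measurable_funTS.
- exists B; split; first exact: num_real.
  by move=> M BM xi /= xi01; apply: le_trans (wB _ xi01) (ltW BM).
Qed.

(** Fubini's theorem, applied on the plane to the integrand restricted to the
    strip 0 <= xi <= 1, where it is dominated by a constant times K(x). The phase
    c is free, so that cosine and sine transforms are covered together. *)
Lemma Rintegral_fejerM_fourier (w c : R -> R) (B : R) :
  measurable_fun [set: R] w -> measurable_fun [set: R] c ->
  (forall xi, I01 xi -> `|w xi| <= B) ->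
  \int[mu]_x (fejer x *
     \int[mu]_(xi in I01) (w xi * cos (2 * pi * x * xi + c xi))) =
  \int[mu]_(xi in I01) (w xi * ((1 - xi) * cos (c xi))).
Proof.
move=> mw mc wB.
have mI01 : measurable (I01 : set (measurableTypeR R)) by exact: measurable_itv.
pose W : R -> R := w \_ I01.
have mW : measurable_fun [set: R] W.
  by apply/(measurable_restrictT _ (measurable_itv _)); exact: measurable_funTS.
have WB xi : `|W xi| <= `|B| * \1_I01 xi.
  rewrite /W patchE indicE; case: ifPn => [|_]; last by rewrite normr0 mulr0.
  by rewrite inE => /wB h; rewrite mulr1 (le_trans h)// ler_norm.
pose f (z : R * R) : \bar R :=
  (fejer z.1 * (W z.2 * cos (2 * pi * z.1 * z.2 + c z.2)))%:E.
have mf : measurable_fun [set: R * R] f.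
  apply/measurable_EFinP; apply: measurable_funM.
    by apply: (measurableT_comp (@measurable_fejer R)); exact: measurable_fst.
  apply: measurable_funM; first by apply: (measurableT_comp mW); exact: measurable_snd.
  apply: (measurableT_comp (@measurable_cos R)); apply: measurable_funD.
    apply: measurable_funM; last exact: measurable_snd.
    by apply: measurable_funM => //; exact: measurable_fst.
  by apply: (measurableT_comp mc); exact: measurable_snd.
pose g (z : R * R) : \bar R := (fejer z.1 * (`|B| * \1_I01 z.2))%:E.
have mI : measurable_fun [set: R] (\1_I01 : R -> R) by exact: measurable_indic.
have mg : measurable_fun [set: R * R] g.
  apply/measurable_EFinP; apply: measurable_funM.
    by apply: (measurableT_comp (@measurable_fejer R)); exact: measurable_fst.
  apply: measurable_funM => //; apply: (measurableT_comp mI); exact: measurable_snd.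
have ig : (mu \x mu)%E.-integrable [set: R * R] g.
  apply/(integrable12ltyP mu mu mg).
  rewrite [ltLHS](_ : _ = \int[mu]_x (`|B| * fejer x)%:E)%E; last first.
    apply: eq_integral => x _.
    transitivity (\int[mu]_xi ((`|B| * fejer x)%:E * (\1_I01 xi)%:E))%E.
      apply: eq_integral => xi _; rewrite /g /= ger0_norm.
        by rewrite -EFinM; congr EFin; ring.
      by rewrite mulr_ge0 ?fejer_ge0// mulr_ge0// indicE.
    rewrite ge0_integralZl_EFin//; last 2 first.
    - by apply/measurable_EFinP.
    - by rewrite mulr_ge0 ?fejer_ge0.
    rewrite integral_indic//.
    rewrite setIT /= lebesgue_measure_itv/= lte_fin ltr01 -EFinB subr0 mule1.
    by [].
  under eq_integral do rewrite EFinM.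
  rewrite ge0_integralZl_EFin//.
  - by rewrite integral_fejer mule1 ltry.
  - by move=> x _; rewrite lee_fin fejer_ge0.
  - by apply/measurable_EFinP; exact: measurable_fejer.
have ifx : (mu \x mu)%E.-integrable [set: R * R] f.
  apply: le_integrable ig => // -[x xi] _ /=.
  rewrite lee_fin !normrM normr_id ler_wpM2l// -[leRHS]mulr1 ler_pM//.
    by rewrite (le_trans (WB _))// ler_wpM2l// ler_norm.
  exact: cos_max.
have fub := Fubini ifx.
have intx x : mu.-integrable I01
    (EFin \o (fun xi => w xi * cos (2 * pi * x * xi + c xi))).
  apply: (@integrable01 _ B) => [|xi /wB]; last first.
    by rewrite normrM; apply: le_trans; rewrite ler_piMr// cos_max.
  apply: measurable_funM => //; apply: (measurableT_comp (@measurable_cos R)).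
  by apply: measurable_funD => //; exact: mulrl_measurable.
have intxi xi : mu.-integrable setT
    (EFin \o (fun x => fejer x * cos (2 * pi * x * xi + c xi))).
  apply: (@integrable_fejerM _ _ 1) => [|x]; last exact: cos_max.
  have := measurable_cos_affine (2 * pi * xi) (c xi).
  by congr measurable_fun; apply/funext => x; congr (cos (_ + _)); ring.
have lhs x : (\int[mu]_xi f (x, xi) = (fejer x *
     \int[mu]_(xi in I01) (w xi * cos (2 * pi * x * xi + c xi)))%:E)%E.
  rewrite EFinM /Rintegral fineK; last exact: (integrable_fin_num _ (intx x)).
  rewrite -(integralZl mI01 (intx x)) [RHS]integral_mkcond; apply: eq_integral => xi _.
  by rewrite /f /W !patchE /=; case: ifPn => // _; rewrite mul0r mulr0.
have rhs xi : (\int[mu]_x f (x, xi) =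
    (((fun xi => w xi * ((1 - xi) * cos (c xi))) \_ I01) xi)%:E)%E.
  rewrite patchE; case: ifPn => [xi01|xi01]; last first.
    rewrite -[RHS](integral0 mu setT); apply: eq_integral => x _.
    by rewrite /f /W /= patchE (negbTE xi01) mul0r mulr0.
  rewrite -Rintegral_fejerM_cos; last by move: xi01; rewrite inE/= in_itv.
  rewrite EFinM /Rintegral fineK; last exact: (integrable_fin_num _ (intxi xi)).
  rewrite -(integralZl measurableT (intxi xi)); apply: eq_integral => x _.
  by rewrite /f /W /= patchE xi01 -EFinM; congr EFin; ring.
rewrite /Rintegral.
under eq_integral do rewrite -lhs.
rewrite fub [in RHS]integral_mkcond; congr fine.
apply: eq_integral => xi _.
by rewrite rhs !patchE; case: ifPn.
Qed.

Lemma Rintegral01_FTC (f F : R -> R) : continuous f ->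
  (forall x : R, is_derive x 1 F (f x)) ->
  \int[mu]_(x in I01) f x = F 1 - F 0.
Proof.
move=> cf dF; rewrite /Rintegral (@continuous_FTC2 _ f F 0 1) ?ltr01//.
- exact: continuous_subspaceT.
- split.
  + by move=> x _; exact: ex_derive.
  + apply: cvg_at_right_filter; apply: differentiable_continuous.
    by apply/derivable1_diffP; exact: ex_derive.
  + apply: cvg_at_left_filter; apply: differentiable_continuous.
    by apply/derivable1_diffP; exact: ex_derive.
- by move=> x _; rewrite derive1E; exact: derive_val.
Qed.

End FejerFubini.

(** * Elementary integrals over the unit interval *)

Section FourierIntegrals.
Variable R : realType.
Local Notation mu := (@lebesgue_measure R).
Local Notation I01 := `[(0 : R), (1 : R)]%classic.
Implicit Types (x t xi w : R).

Lemma is_derive_sinM w x : is_derive x 1 (fun xi => sin (w * xi)) (w * cos (w * x)).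
Proof.
have h : is_derive x 1 (fun xi : R => w * xi) w.
  by apply: is_derive_eq; rewrite /GRing.scale /=; ring.
by have := is_derive1_comp (is_derive_sin (w * x)) h; rewrite mulrC.
Qed.

Lemma is_derive_cosM w x : is_derive x 1 (fun xi => cos (w * xi)) (- (w * sin (w * x))).
Proof.
have h : is_derive x 1 (fun xi : R => w * xi) w.
  by apply: is_derive_eq; rewrite /GRing.scale /=; ring.
by have := is_derive1_comp (is_derive_cos (w * x)) h; rewrite mulNr mulrC.
Qed.

Let continuous_trig (h : R -> R) w : continuous h ->
  continuous (fun xi => h (w * xi)).
Proof.
move=> ch xi; apply: (@continuous_comp _ _ _ ( *%R w) h); last exact: ch.
exact: mulrl_continuous.
Qed.

Lemma Rintegral01_sin w : w != 0 ->
  \int[mu]_(xi in I01) sin (w * xi) = (1 - cos w) / w.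
Proof.
move=> w0; pose F xi := - (cos (w * xi) / w).
transitivity (F 1 - F 0); last by rewrite /F mulr1 mulr0 cos0; field.
apply: Rintegral01_FTC => [|x].
  by apply: continuous_trig; exact: continuous_sin.
have h := is_derive_cosM w x.
by apply: is_derive_eq; rewrite /GRing.scale /=; field.
Qed.

Let continuous_onemM (h : R -> R) : continuous h ->
  continuous (fun xi => (1 - xi) * h xi).
Proof.
by move=> ch xi; apply: cvgM; [apply: cvgB; [exact: cvg_cst|exact: cvg_id]|exact: ch].
Qed.

Lemma Rintegral01_onemM_cos w : w != 0 ->
  \int[mu]_(xi in I01) ((1 - xi) * cos (w * xi)) = (1 - cos w) / w ^+ 2.
Proof.
move=> w0; pose F xi := (1 - xi) * sin (w * xi) / w - cos (w * xi) / w ^+ 2.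
transitivity (F 1 - F 0); last by rewrite /F mulr1 mulr0 cos0 sin0; field.
apply: Rintegral01_FTC => [|x].
  by apply/continuous_onemM/continuous_trig; exact: continuous_cos.
have h1 := is_derive_cosM w x; have h2 := is_derive_sinM w x.
by apply: is_derive_eq; rewrite /GRing.scale /=; field.
Qed.

Lemma Rintegral01_onemM_sin w : w != 0 ->
  \int[mu]_(xi in I01) ((1 - xi) * sin (w * xi)) = w^-1 - sin w / w ^+ 2.
Proof.
move=> w0; pose F xi := - ((1 - xi) * cos (w * xi) / w) - sin (w * xi) / w ^+ 2.
transitivity (F 1 - F 0); last by rewrite /F mulr1 mulr0 cos0 sin0; field.
apply: Rintegral01_FTC => [|x].
  by apply/continuous_onemM/continuous_trig; exact: continuous_sin.
have h1 := is_derive_cosM w x; have h2 := is_derive_sinM w x.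
by apply: is_derive_eq; rewrite /GRing.scale /=; field.
Qed.

Lemma Rintegral01_onem2M_cos w : w != 0 ->
  \int[mu]_(xi in I01) ((1 - xi) * ((1 - xi) * cos (w * xi))) =
  2 / w ^+ 2 - 2 * sin w / w ^+ 3.
Proof.
move=> w0; pose F xi := (1 - xi) * (1 - xi) * sin (w * xi) / w
  - 2 * ((1 - xi) * cos (w * xi)) / w ^+ 2 - 2 * sin (w * xi) / w ^+ 3.
transitivity (F 1 - F 0); last by rewrite /F mulr1 mulr0 cos0 sin0; field.
apply: Rintegral01_FTC => [|x].
  by do 2 apply: continuous_onemM; apply: continuous_trig; exact: continuous_cos.
have h1 := is_derive_cosM w x; have h2 := is_derive_sinM w x.
by apply: is_derive_eq; rewrite /GRing.scale /=; field.
Qed.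

End FourierIntegrals.

(** * The autocorrelation of the Fejer kernel *)

Section FejerCorrelation.
Variable R : realType.
Local Notation mu := (@lebesgue_measure R).
Local Notation I01 := `[(0 : R), (1 : R)]%classic.
Implicit Types (x y t xi : R).

(** The autocorrelation in Fourier form, the transform of (1 - |xi|)^2. Unlike its
    closed form it has no singularity at t = 0. *)
Definition fejer_corr t : R :=
  \int[mu]_(xi in I01) (2 * (1 - xi) * ((1 - xi) * cos (2 * pi * t * xi))).

Lemma onem_cos2pi t : 1 - cos (2 * pi * t) = 2 * sin (pi * t) ^+ 2.
Proof.
have -> : 2 * pi * t = (pi * t) *+ 2 by ring.
by rewrite cos_mulr2n sin2cos2; ring.
Qed.

Let twopiM_neq0 t : t != 0 -> 2 * pi * t != 0.
Proof. by move=> t0; rewrite !mulf_neq0// lt0r_neq0// pi_gt0. Qed.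

Let measurable_cosM t : measurable_fun [set: R] (fun xi => cos (2 * pi * t * xi)).
Proof.
by have := measurable_cos_affine (2 * pi * t) 0; under eq_fun do rewrite addr0.
Qed.

Let measurable_onem : measurable_fun [set: R] (fun xi => 1 - xi).
Proof. exact: measurable_funB. Qed.

Let onem_le1 xi : I01 xi -> `|1 - xi| <= 1.
Proof. by rewrite /= in_itv/= ler_norml; lra. Qed.

Let integrable01_onemM_cos t :
  mu.-integrable I01 (EFin \o (fun xi => (1 - xi) * cos (2 * pi * t * xi))).
Proof.
apply: (@integrable01 _ _ 1); first exact: measurable_funM.
by move=> xi /onem_le1 h; rewrite normrM mulr_ile1// cos_max.
Qed.

Let integrable01_onem2M_cos t : mu.-integrable I01
  (EFin \o (fun xi => (1 - xi) * ((1 - xi) * cos (2 * pi * t * xi)))).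
Proof.
apply: (@integrable01 _ _ 1).
  by apply: measurable_funM => //; exact: measurable_funM.
by move=> xi /onem_le1 h; rewrite !normrM !mulr_ile1 ?mulr_ge0// cos_max.
Qed.

Let integrable01_sin t :
  mu.-integrable I01 (EFin \o (fun xi => sin (2 * pi * t * xi))).
Proof.
apply: (@integrable01 _ _ 1); last by move=> xi _; exact: sin_max.
by apply: (measurableT_comp (@measurable_sin R)); exact: mulrl_measurable.
Qed.

Lemma fejer_fourier t : t != 0 ->
  \int[mu]_(xi in I01) (2 * (1 - xi) * cos (2 * pi * t * xi)) = fejer t.
Proof.
move=> t0; under eq_Rintegral do rewrite -mulrA.
rewrite RintegralZl// Rintegral01_onemM_cos ?twopiM_neq0// onem_cos2pi fejerE /sinsq.
by move: pi (pi_gt0 R) => p /lt0r_neq0 p0; field; rewrite p0 t0.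
Qed.

(** One factor 1 - xi comes from writing K(x+t) as a Fourier integral, the other
    from the Fourier transform of K(x). *)
Lemma Rintegral_fejerM_shift t :
  \int[mu]_x (fejer x * fejer (x + t)) = fejer_corr t.
Proof.
rewrite /fejer_corr.
rewrite -(@Rintegral_fejerM_fourier _ (fun xi => 2 * (1 - xi))
  (fun xi => 2 * pi * t * xi) 2).
- apply/esym/(@Rintegral_eq_off_countable _ [set - t]) => //.
    move=> x /eqP xt; congr (_ * _); rewrite -fejer_fourier ?addr_eq0//.
    by apply: eq_Rintegral => xi _; congr (_ * cos _); ring.
  apply: measurable_funM; first exact: measurable_fejer.
  by apply: (measurableT_comp (@measurable_fejer R)); exact: measurable_funD.
- exact: measurable_funM.
- exact: mulrl_measurable.
- by move=> xi /onem_le1 h; rewrite normrM ger0_norm// ger_pMr.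
Qed.

(** The function 2 S(y)/y is the sine transform of the constant 2/pi on [0,1];
    the phase - pi/2 turns that sine into a cosine. *)
Lemma Rintegral_fejerM_sinsq_div t : t != 0 ->
  \int[mu]_x (fejer x * (2 * (sinsq (x + t) / (x + t)))) =
  (pi ^+ 2 * t)^-1 - sin (2 * pi * t) / (2 * pi ^+ 3 * t ^+ 2).
Proof.
move=> t0.
have fourier y :
    \int[mu]_(xi in I01) (2 / pi * sin (2 * pi * y * xi)) = 2 * (sinsq y / y).
  rewrite RintegralZl//.
  have [->|y0] := eqVneq y 0.
    rewrite invr0 !mulr0; under eq_Rintegral do rewrite mul0r sin0.
    by rewrite Rintegral_cst//= mul0r mulr0.
  rewrite Rintegral01_sin ?twopiM_neq0// onem_cos2pi /sinsq.
  by move: pi (pi_gt0 R) => p /lt0r_neq0 p0; field; rewrite p0 y0.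
transitivity (\int[mu]_(xi in I01)
    (2 / pi * ((1 - xi) * cos (2 * pi * t * xi - pi / 2)))).
  rewrite -(@Rintegral_fejerM_fourier _ (fun=> 2 / pi)
    (fun xi => 2 * pi * t * xi - pi / 2) `|2 / pi|)//.
    apply: eq_Rintegral => x _; congr (_ * _); rewrite -fourier.
    apply: eq_Rintegral => xi _; rewrite -cosBpihalf; congr (_ * cos _); ring.
  by apply: measurable_funB => //; exact: mulrl_measurable.
under eq_Rintegral do rewrite cosBpihalf.
rewrite RintegralZl//; last first.
  apply: (@integrable01 _ _ 1).
    apply: measurable_funM => //.
    by apply: (measurableT_comp (@measurable_sin R)); exact: mulrl_measurable.
  by move=> xi /onem_le1 h; rewrite normrM mulr_ile1// sin_max.
rewrite Rintegral01_onemM_sin ?twopiM_neq0//.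
by move: (sin _) => S; move: pi (pi_gt0 R) => p /lt0r_neq0 p0; field; rewrite p0 t0.
Qed.

Lemma fejer_corrE t : t != 0 -> fejer_corr t =
  (pi ^+ 2 * t ^+ 2)^-1 - sin (2 * pi * t) / (2 * pi ^+ 3 * t ^+ 3).
Proof.
move=> t0; rewrite /fejer_corr; under eq_Rintegral do rewrite -mulrA.
rewrite RintegralZl// Rintegral01_onem2M_cos ?twopiM_neq0//.
by move: (sin _) => S; move: pi (pi_gt0 R) => p /lt0r_neq0 p0; field; rewrite p0 t0.
Qed.

Lemma fejer_corrN t : fejer_corr (- t) = fejer_corr t.
Proof. by apply: eq_Rintegral => xi _; rewrite mulrN mulNr cosN. Qed.

Lemma fejer_corr_ge0 t : 0 <= fejer_corr t.
Proof.
rewrite -Rintegral_fejerM_shift; apply: Rintegral_ge0 => x _.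
by rewrite mulr_ge0 ?fejer_ge0.
Qed.

(** Only the limit at 0 matters later, and |cos u - 1| <= |u| under the integral
    is enough for it. *)
Lemma fejer_corr_lipschitz0 t : `|fejer_corr t - fejer_corr 0| <= 4 * pi * `|t|.
Proof.
have onem_cos_le (u : R) : `|cos (2 * pi * u) - 1| <= 2 * pi * `|u|.
  rewrite distrC onem_cos2pi (ger0_norm (mulr_ge0 _ (sqr_ge0 _)))// -mulrA ler_pM2l//.
  rewrite -real_normK ?num_real// expr2.
  apply: (le_trans (ler_piMl (normr_ge0 _) (sin_max _))).
  by rewrite (le_trans (normr_sin_le _))// normrM (ger0_norm (pi_ge0 R)).
rewrite /fejer_corr; under eq_Rintegral do rewrite -mulrA.
under [X in _ - X]eq_Rintegral do rewrite -mulrA.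
rewrite !RintegralZl// -mulrBr -RintegralB// normrM ger0_norm//.
have -> : 4 * pi * `|t| = 2 * (2 * pi * `|t|) by ring.
rewrite ler_pM2l//.
have mI01 : measurable (I01 : set (measurableTypeR R)) by exact: measurable_itv.
have iB := integrableB mI01 (integrable01_onem2M_cos t) (integrable01_onem2M_cos 0).
apply: (le_trans (le_normr_Rintegral mI01 iB)).
have -> : 2 * pi * `|t| = \int[mu]_(xi in I01) (2 * pi * `|t|).
  rewrite Rintegral_cst; last exact: measurable_itv.
  by rewrite /= lebesgue_measure_itv/= lte_fin ltr01/= subr0 mulr1.
apply: le_Rintegral => //.
- exact: integrable_norm iB.
- apply: (@integrable01 _ _ `|2 * pi * `|t| |) => //; exact: measurable_cst.
- move=> xi xi01; rewrite /= mulr0 mul0r cos0 -!mulrBr !normrM.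
  have /onem_le1 h := xi01.
  apply: (le_trans (ler_piMl _ h)); first by rewrite mulr_ge0.
  apply: (le_trans (ler_piMl _ h)) => //.
  rewrite -mulrA; apply: (le_trans (onem_cos_le _)).
  rewrite ler_pM2l ?mulr_gt0 ?pi_gt0// normrM ler_piMr//.
  by move: xi01; rewrite /= in_itv/= => /andP[? ?]; rewrite ger0_norm.
Qed.

Lemma fejer_corr_le t : t != 0 -> fejer_corr t <= 2 / (pi ^+ 2 * t ^+ 2).
Proof.
move=> t0; rewrite fejer_corrE//.
have h : `|sin (2 * pi * t) / (2 * pi * t)| <= 1.
  rewrite normrM normfV ler_pdivrMr ?normr_gt0 ?twopiM_neq0// mul1r.
  exact: normr_sin_le.
have -> : (pi ^+ 2 * t ^+ 2)^-1 - sin (2 * pi * t) / (2 * pi ^+ 3 * t ^+ 3) =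
  (1 - sin (2 * pi * t) / (2 * pi * t)) / (pi ^+ 2 * t ^+ 2).
  by move: (sin _) => S; move: pi (pi_gt0 R) => p /lt0r_neq0 p0; field; rewrite p0 t0.
rewrite ler_wpM2r//; first by rewrite invr_ge0 -exprMn sqr_ge0.
by move: h; move: (_ / _) => q; rewrite ler_norml => /andP[? ?]; lra.
Qed.

End FejerCorrelation.

(** * Sums of the autocorrelation over integer translates *)

Section CorrSeries.
Variable R : realType.
Local Notation mu := (@lebesgue_measure R).
Implicit Types (x y t beta : R) (s : bool) (n : int).

(** By periodicity sin(2 pi y) = - sin(2 pi (n - y)), which brings the summand into
    the closed form of the autocorrelation. *)
Lemma term_formulaE s n y : n%:~R != y ->
  term_formula s n y = sgnpm R s n * (2 * pi ^+ 2 * fejer_corr (n%:~R - y)).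
Proof.
rewrite -subr_eq0 => t0; rewrite fejer_corrE// /term_formula.
have -> : sin (2 * pi * y) = - sin (2 * pi * (n%:~R - y)).
  pose f (z : R) := sin (2 * pi * z).
  have f1 z : f (z + 1) = f z.
    by rewrite /f -[RHS]sinD2pi; congr sin; ring.
  by rewrite -sinN -[LHS]/(f y) -(periodic_int f1 y (- n)) /f mulrNz; congr sin; ring.
move: (n%:~R - y) t0 => t t0; move: (sin _) => S.
by move: pi (pi_gt0 R) => p /lt0r_neq0 p0; field; rewrite p0 t0.
Qed.

Lemma termE s n beta :
  term s n beta = sgnpm R s n * (2 * pi ^+ 2 * fejer_corr (n%:~R - beta)).
Proof.
rewrite /term; case: ifPn => [/eqP <-|]; last exact: term_formulaE.
rewrite subrr /removed; apply/cvg_lim => //.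
apply: (@cvg_trans _ ((sgnpm R s n * (2 * pi ^+ 2 * fejer_corr (n%:~R - y)))
  @[y --> (n%:~R : R)^'])).
  apply: near_eq_cvg; near=> y; rewrite term_formulaE// eq_sym.
  by near: y; exact: nbhs_dnbhs_neq.
apply: cvgMl_tmp; apply: cvgMl_tmp.
apply/cvgrPdist_le => e e0; near=> y.
rewrite distrC (le_trans (fejer_corr_lipschitz0 _))//.
rewrite -ler_pdivlMl ?mulr_gt0 ?pi_gt0// mulrC.
near: y; apply: nbhs_dnbhs; exists (e / (4 * pi)) => /=.
  by rewrite divr_gt0 ?mulr_gt0 ?pi_gt0.
by move=> y; exact: ltW.
Unshelve. all: end_near. Qed.

(** At the integers the left factor vanishes. *)
Lemma sinsq_trigamma_le1 x : 0 <= sinsq x * trigamma x <= 1.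
Proof.
rewrite mulr_ge0 ?sinsq_ge0 ?trigamma_ge0//=.
have [/intrP[m ->]|xint] := boolP (x \is a Num.int).
  rewrite -[m%:~R]add0r (periodic_int (@sinsqD1 R)).
  by rewrite /sinsq mulr0 sin0 mul0r expr0n/= mul0r.
rewrite -(sinsq_trigamma xint) ler_wpM2l ?sinsq_ge0// lerDl.
exact: trigamma_ge0.
Qed.

Lemma normr_sinsq_trigamma x : `|sinsq x * trigamma x| <= 1.
Proof. by have /andP[? ?] := sinsq_trigamma_le1 x; rewrite ger0_norm. Qed.

Lemma measurable_sinsq_trigamma_shift t :
  measurable_fun [set: R] (fun x => sinsq (x + t) * trigamma (x + t)).
Proof.
have := measurableT_comp (@measurable_sinsq_trigamma R).
by apply; exact: measurable_funD.
Qed.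

(** The sum of c(t+k) over k >= 0, with the summation carried out under the
    integral: sum_(k >= 0) K(x+t+k) = S(x+t) psi(x+t). *)
Definition corr_sum t : R :=
  \int[mu]_x (fejer x * (sinsq (x + t) * trigamma (x + t))).

Lemma integrable_corr_sum t : mu.-integrable [set: R]
  (EFin \o (fun x => fejer x * (sinsq (x + t) * trigamma (x + t)))).
Proof.
apply: (@integrable_fejerM _ _ 1); first exact: measurable_sinsq_trigamma_shift.
by move=> x; exact: normr_sinsq_trigamma.
Qed.

Lemma measurable_fejer_shift t : measurable_fun [set: R] (fun x => fejer (x + t)).
Proof.
by apply: (measurableT_comp (@measurable_fejer R)); exact: measurable_funD.
Qed.

Lemma integrable_fejerM_shift t :
  mu.-integrable [set: R] (EFin \o (fun x => fejer x * fejer (x + t))).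
Proof.
apply: (@integrable_fejerM _ _ 1); first exact: measurable_fejer_shift.
by move=> x; rewrite ger0_norm ?fejer_ge0 ?fejer_le1.
Qed.

Lemma cvg_corr_sum t :
  series (fun k => fejer_corr (t + k%:R)) @ \oo --> corr_sum t.
Proof.
have e : (\sum_(0 <= k <oo) (fejer_corr (t + k%:R))%:E = (corr_sum t)%:E)%E.
  transitivity (\int[mu]_x \sum_(0 <= k <oo) (fejer x * fejer (x + (t + k%:R)))%:E)%E.
    rewrite integral_nneseries//.
    - apply: eq_eseriesr => k _; rewrite -Rintegral_fejerM_shift /Rintegral fineK//.
      exact: (integrable_fin_num _ (integrable_fejerM_shift _)).
    - move=> k; apply/measurable_EFinP; apply: measurable_funM.
        exact: measurable_fejer.
      exact: measurable_fejer_shift.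
    - by move=> k x _; rewrite lee_fin mulr_ge0 ?fejer_ge0.
  rewrite /corr_sum /Rintegral fineK; last first.
    exact: (integrable_fin_num _ (integrable_corr_sum _)).
  apply: eq_integral => x _; apply: nneseries_EFin.
  rewrite (_ : series _ = fun N => fejer x * series (fun k => fejer (x + t + k%:R)) N).
    by apply: cvgMl_tmp; exact: cvg_series_fejer.
  apply/funext => N; rewrite /series/= mulr_sumr; apply: eq_bigr => k _.
  by rewrite addrA.
have cv : cvgn (fun n : nat => \sum_(0 <= k < n) (fejer_corr (t + k%:R))%:E)%E.
  by apply: is_cvg_ereal_nneg_natsum => k _; rewrite lee_fin fejer_corr_ge0.
move/cvg_ex : cv => [l cl]; move: e; rewrite (cvg_lim _ cl)// => e.
move: cl; rewrite e; under eq_fun do rewrite sumEFin.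
by move/fine_cvg.
Qed.

Lemma corr_sumS t : corr_sum t = fejer_corr t + corr_sum (t + 1).
Proof.
have := @cvg_corr_sum t; rewrite -cvg_shiftS => /cvg_lim <-//.
apply/cvg_lim => //.
rewrite (_ : [sequence _]_n =
    fun n : nat => fejer_corr t + series (fun k => fejer_corr (t + 1 + k%:R)) n).
  by apply: cvgD; [exact: cvg_cst|exact: cvg_corr_sum].
apply/funext => n; rewrite /= /series/= big_nat_recl// addr0; congr (_ + _).
by apply: eq_bigr => k _; rewrite -natr1 [k%:R + 1]addrC addrA.
Qed.

End CorrSeries.

Section CorrSum.
Variable R : realType.
Local Notation mu := (@lebesgue_measure R).
Implicit Types (x y t beta : R) (s : bool) (n : int).

(** After x -> -x in the second integral, the integrands add up to
    K(x) S(y) (psi(y) + psi(1-y)) = K(x), where y = x+t. *)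
Lemma corr_sum_onem t : corr_sum t + corr_sum (1 - t) = 1.
Proof.
pose f x : R := fejer x * (sinsq (x + (1 - t)) * trigamma (x + (1 - t))).
have fi : mu.-integrable setT (EFin \o f) by exact: integrable_corr_sum.
have mf : measurable_fun [set: R] f by apply/measurable_EFinP; exact: measurable_int fi.
have fNi : mu.-integrable setT (EFin \o (fun x => f (- x))) by exact: integrable_opp fi.
rewrite [corr_sum (1 - t)](_ : _ = \int[mu]_x f (- x)); last first.
  by rewrite Rintegral_opp.
rewrite -RintegralD//; last exact: integrable_corr_sum.
rewrite -[RHS](Rintegral_fejer R).
apply: (Rintegral_eq_off_countable (N := [set x | x + t \is a Num.int])).
- by apply: (@countable_int _ (fun x => x + t) (fun y => y - t)) => x; rewrite addrK.
- move=> x /negP xt; rewrite /f fejerN -mulrDr.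
  have -> : - x + (1 - t) = 1 - (x + t) by ring.
  by rewrite sinsq_onem -mulrDr sinsq_trigamma// mulr1.
- exact: measurable_fejer.
Qed.

(** Up to the factor 2 pi^2, the half n < 0 is - C(beta+1), and the half
    n >= 0 is its first term plus C(1-beta) = 1 - C(beta) = 1 - c(beta) - C(beta+1). *)
Lemma bisum_term s beta : bisum (fun n => term s n beta) =
  2 * pi ^+ 2 * (1 - (1 - (-1) ^+ s) * fejer_corr beta - 2 * corr_sum (beta + 1)).
Proof.
set c : R := 2 * pi ^+ 2; rewrite /bisum.
rewrite [X in X + _ = _](_ : _ =
    (-1) ^+ s * (c * fejer_corr beta) + c * corr_sum (1 - beta)); last first.
  apply/cvg_lim => //; rewrite -cvg_shiftS.
  rewrite (_ : [sequence _]_n = fun N => (-1) ^+ s * (c * fejer_corr beta) +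
      c * series (fun k => fejer_corr (1 - beta + k%:R)) N).
    by apply: cvgD; [exact: cvg_cst|apply: cvgMl_tmp; exact: cvg_corr_sum].
  apply/funext => N; rewrite /= big_nat_recl// termE /= sub0r fejer_corrN; congr (_ + _).
  rewrite mulr_sumr; apply: eq_bigr => k _; rewrite termE /sgnpm/= mul1r.
  by congr (_ * fejer_corr _); rewrite -pmulrn -natr1; ring.
rewrite [X in _ + X = _](_ : _ = - (c * corr_sum (beta + 1))); last first.
  apply/cvg_lim => //.
  rewrite (_ : (fun _ => _) =
      fun N => - (c * series (fun k => fejer_corr (beta + 1 + k%:R)) N)).
    by apply: cvgN; apply: cvgMl_tmp; exact: cvg_corr_sum.
  apply/funext => N; rewrite mulr_sumr -sumrN; apply: eq_bigr => k _.
  rewrite termE /sgnpm/= mulN1r -fejer_corrN; congr (- (_ * fejer_corr _)).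
  by rewrite NegzE mulrNz -pmulrn -natr1; ring.
have := corr_sum_onem beta; rewrite (corr_sumS beta) => e.
by rewrite -[X in X - _ - _]e; ring.
Qed.

(** For y = beta+1+k, the closed form of c(y) differs from 1/(pi^2 y^2) by at most
    1/(2 pi^3 y^3) <= d/y^2, where d = 1/(2 pi^3 beta). So C(beta+1) lies between
    (1/pi^2 - d) psi(beta+1) and (1/pi^2 + d) psi(beta+1), where
    1/beta - 1/beta^2 <= psi(beta+1) <= 1/beta. *)
Lemma corr_sum_asymptotic beta : 0 < beta ->
  `|corr_sum (beta + 1) - (pi ^+ 2 * beta)^-1| <=
    (pi ^- 2 + (2 * pi ^+ 3)^-1) / beta ^+ 2.
Proof.
move=> b0; pose d : R := (2 * pi ^+ 3 * beta)^-1.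
have p0 := pi_gt0 R.
have d0 : 0 < d by rewrite invr_gt0 !mulr_gt0 ?exprn_gt0.
have bound k : `|fejer_corr (beta + 1 + k%:R) - pi ^- 2 * trigamma_term (beta + 1) k|
    <= d * trigamma_term (beta + 1) k.
  rewrite /trigamma_term; set y := beta + 1 + k%:R.
  have by_ : beta <= y by rewrite /y -addrA lerDl.
  have y0 : 0 < y by exact: lt_le_trans b0 by_.
  rewrite fejer_corrE ?lt0r_neq0// invfM addrAC subrr add0r normrN normrM.
  rewrite normfV (@ger0_norm _ (_ * _ * _)) ?mulr_ge0 ?exprn_ge0 ?(ltW p0) ?(ltW y0)//.
  apply: (le_trans (ler_piMl _ (sin_max _))).
    by rewrite invr_ge0 ?mulr_ge0 ?exprn_ge0 ?(ltW p0) ?(ltW y0).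
  rewrite /d -invfM lef_pV2 ?posrE ?mulr_gt0 ?exprn_gt0//.
  by rewrite [y ^+ 3]exprS [leRHS]mulrA ler_pM2r ?exprn_gt0//
    ler_pM2l ?mulr_gt0 ?exprn_gt0.
have cT := @cvg_trigamma R (beta + 1).
have cS := @cvg_corr_sum R (beta + 1).
have sum_bound N :
    (pi ^- 2 - d) * series (trigamma_term (beta + 1)) N <=
    series (fun k => fejer_corr (beta + 1 + k%:R)) N <=
    (pi ^- 2 + d) * series (trigamma_term (beta + 1)) N.
  rewrite /series/= !mulr_sumr; apply/andP; split; apply: ler_sum => k _;
  by have := bound k; rewrite ler_norml mulrDl ?mulNr => /andP[? ?]; lra.
have up : corr_sum (beta + 1) <= (pi ^- 2 + d) * trigamma (beta + 1).
  apply: ler_cvg_to cS (cvgMl_tmp cT) _.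
  by apply: nearW => N; have /andP[] := sum_bound N.
have lo : (pi ^- 2 - d) * trigamma (beta + 1) <= corr_sum (beta + 1).
  apply: ler_cvg_to (cvgMl_tmp cT) cS _.
  by apply: nearW => N; have /andP[] := sum_bound N.
have T1 := trigammaS_le b0.
have T2 : beta^-1 - beta ^- 2 <= trigamma (beta + 1).
  by have := trigamma_ge b0; rewrite trigammaS; lra.
have T0 : 0 <= trigamma (beta + 1) by exact: trigamma_ge0.
have dT : d * trigamma (beta + 1) <= (2 * pi ^+ 3)^-1 / beta ^+ 2.
  have -> : (2 * pi ^+ 3)^-1 / beta ^+ 2 = d * beta^-1.
    by rewrite /d; move: pi p0 => p /lt0r_neq0 p0; field; rewrite p0 lt0r_neq0.
  by rewrite ler_pM2l.
have q0 : 0 <= pi ^- 2 :> R by rewrite invr_ge0 sqr_ge0.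
have q1 := ler_wpM2l q0 T1; have q2 := ler_wpM2l q0 T2.
have b2 : 0 <= beta ^- 2 by rewrite invr_ge0 sqr_ge0.
have q3 := mulr_ge0 q0 b2.
rewrite invfM; move: up lo; rewrite mulrDl mulrBl => up lo.
rewrite ler_norml [_ / beta ^+ 2]mulrDl.
move: q2; rewrite mulrBr => q2.
move: (pi ^- 2 * beta^-1) (pi ^- 2 * trigamma (beta + 1)) (d * trigamma (beta + 1))
  (pi ^- 2 / beta ^+ 2) ((2 * pi ^+ 3)^-1 / beta ^+ 2) up lo dT q1 q2 q3.
move=> u1 u2 u3 u4 u5 ? ? ? ? ? ?; apply/andP; split; lra.
Qed.

End CorrSum.

(** * Evaluation of the functional *)

Section Main.
Variable R : realType.
Local Notation mu := (@lebesgue_measure R).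
Implicit Types (x y t beta : R) (s : bool) (n : int).

(** H_0 - sgn, set to 0 at the integers so that Beurling's inequality and oddness
    hold everywhere. *)
Definition H0_excess y : R :=
  if y \is a Num.int then 0 else H0_formula y - Num.sg y.

Lemma H0_excess_odd y : H0_excess (- y) = - H0_excess y.
Proof.
rewrite /H0_excess rpredN; case: ifPn => _; first by rewrite oppr0.
by rewrite H0_formula_odd sgrN; ring.
Qed.

Lemma normr_H0_excess y : `|H0_excess y| <= fejer y.
Proof.
rewrite /H0_excess; case: ifPn => [_|]; last exact: normr_H0_formula_sgr.
by rewrite normr0 fejer_ge0.
Qed.

Lemma measurable_sinsq_div : measurable_fun [set: R] (fun y => sinsq y / y).
Proof.
by apply: measurable_funM; [exact: measurable_sinsq|exact: measurable_inv].
Qed.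

Lemma normr_sinsq_div y : `|sinsq y / y| <= 1.
Proof.
have [->|y0] := eqVneq y 0; first by rewrite invr0 mulr0 normr0.
have p0 := pi_gt0 R.
have -> : sinsq y / y = sin (pi * y) * (sin (pi * y) / (pi * y)) / pi.
  by rewrite /sinsq; move: (sin _) => S; move: pi p0 => p /lt0r_neq0 p0; field; rewrite p0 y0.
have h : `|sin (pi * y) / (pi * y)| <= 1.
  rewrite normrM normfV ler_pdivrMr ?mul1r ?normr_sin_le//.
  by rewrite normr_gt0 mulf_neq0// lt0r_neq0.
have hpi : `|pi^-1 : R| <= 1.
  by rewrite gtr0_norm ?invr_gt0// invf_le1// (le_trans _ (pi_ge2 R))// ler1n.
by rewrite normrM mulr_ile1 ?hpi// normrM mulr_ile1 ?sin_max ?h.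
Qed.

Lemma measurable_sgr : measurable_fun [set: R] (@Num.sg R).
Proof.
apply: nondecreasing_measurable => // x y xy.
have [x0|x0|x0] := ltgtP x 0; have [y0|y0|y0] := ltgtP y 0;
  rewrite ?(gtr0_sg x0) ?(gtr0_sg y0) ?(ltr0_sg x0) ?(ltr0_sg y0) ?x0 ?y0 ?sgr0//; lra.
Qed.

(** The right-hand side of Hpm_eq, rewritten with S(y) = S(y+1). It is defined on
    the whole line and clearly measurable and bounded, and it agrees with H^+- off
    the integers. *)
Definition Hpm_reg s y : R :=
  1 + 2 * (sinsq y / y) - (1 - (-1) ^+ s) * fejer y
    - 2 * (sinsq (y + 1) * trigamma (y + 1)).

Lemma Hpm_regE s y : y \isn't a Num.int -> Hpm s y = Hpm_reg s y.
Proof. by move=> yint; rewrite Hpm_eq// /Hpm_reg sinsqD1. Qed.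

Lemma measurable_Hpm_reg s : measurable_fun [set: R] (Hpm_reg s).
Proof.
apply: measurable_funB; last first.
  by apply: measurable_funM => //; exact: measurable_sinsq_trigamma_shift.
apply: measurable_funB; last by apply: measurable_funM => //; exact: measurable_fejer.
by apply: measurable_funD => //; apply: measurable_funM => //; exact: measurable_sinsq_div.
Qed.

Lemma normr_Hpm_reg s y : `|Hpm_reg s y| <= 7.
Proof.
have h1 := normr_sinsq_div y; have h2 := normr_sinsq_trigamma (y + 1).
have h3 := fejer_ge0 y; have h4 := fejer_le1 y.
rewrite /Hpm_reg; move: h1 h2; rewrite !ler_norml => /andP[? ?] /andP[? ?].
by case: s; rewrite ?expr1 ?expr0; apply/andP; split; lra.
Qed.

Lemma measurable_H0_excess : measurable_fun [set: R] H0_excess.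
Proof.
apply: (@measurable_fun_eq_off_countable _ [set x | x \is a Num.int] _
  (fun y => Hpm_reg false y - fejer y - Num.sg y)).
- exact: (@countable_int _ id id).
- move=> y /negP yint; rewrite /H0_excess (negbTE yint) H0_formula_eq// /Hpm_reg.
  by rewrite sinsqD1; ring.
- apply: measurable_funB; last exact: measurable_sgr.
  by apply: measurable_funB; [exact: measurable_Hpm_reg|exact: measurable_fejer].
Qed.

Lemma integrable_H0_excess : mu.-integrable setT (EFin \o H0_excess).
Proof.
apply: (le_integrable _ _ _ (integrable_fejer R)) => //.
  by apply/measurable_EFinP; exact: measurable_H0_excess.
by move=> x _ /=; rewrite lee_fin (ger0_norm (fejer_ge0 x)) normr_H0_excess.
Qed.

Definition symm (f : R -> R) beta x : R := 2^-1 * (f (x + beta) + f (- x + beta)).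

Lemma integrable_comp_symm (f : R -> R) beta : mu.-integrable setT (EFin \o f) ->
  mu.-integrable setT (EFin \o (fun x => f (x + beta))) /\
  mu.-integrable setT (EFin \o (fun x => f (- x + beta))).
Proof.
move=> fi; have h := integrable_shift beta fi.
by split => //; exact: (integrable_opp h).
Qed.

Lemma integrable_symm f beta : mu.-integrable setT (EFin \o f) ->
  mu.-integrable setT (EFin \o symm f beta).
Proof.
move=> /(integrable_comp_symm beta)[h1 h2].
exact: (integrableZl measurableT _ (integrableD measurableT h1 h2)).
Qed.

(** Symmetrizing does not change an integral over the line, so r_beta^+- may be
    replaced by H^+-(x+beta) wherever the latter is integrable. *)
Lemma Rintegral_symm f beta : mu.-integrable setT (EFin \o f) ->
  \int[mu]_x symm f beta x = \int[mu]_x f x.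
Proof.
move=> fi; have mf : measurable_fun [set: R] f.
  by apply/measurable_EFinP; exact: measurable_int fi.
have [h1 h2] := integrable_comp_symm beta fi.
rewrite RintegralZl//; last exact: (integrableD measurableT h1 h2).
rewrite RintegralD// (Rintegral_opp (f := fun x => f (x + beta))); last first.
  by apply: (measurableT_comp mf); exact: measurable_funD.
by rewrite Rintegral_shift//; field.
Qed.

(** r_beta^+- with the non-integrable sign functions already combined: their average
    (sgn(x+beta) + sgn(-x+beta))/2 is the indicator of ]-beta, beta[ off +-beta. *)
Definition BSr_reg s beta x : R :=
  symm H0_excess beta x + \1_`]- beta, beta[ x +
  (-1) ^+ s * symm (@H1_formula R) beta x.

Lemma nonint_neq0 y : y \isn't a Num.int -> y != 0.
Proof. by apply: contraNneq => ->; rewrite rpred0. Qed.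

Lemma BSr_regE s beta x : 0 < beta ->
  x + beta \isn't a Num.int -> - x + beta \isn't a Num.int ->
  BSr s beta x = BSr_reg s beta x.
Proof.
move=> b0 h1 h2.
have H y : y \isn't a Num.int -> Hpm s y = H0_excess y + Num.sg y + (-1) ^+ s * fejer y.
  by move=> h; rewrite /Hpm /H0 /H1 /H0_excess (negbTE h) (negbTE (nonint_neq0 h)); ring.
have -> : BSr_reg s beta x = symm H0_excess beta x
    + 2^-1 * (Num.sg (x + beta) + Num.sg (- x + beta))
    + (-1) ^+ s * symm (@H1_formula R) beta x.
  congr (_ + _ + _); rewrite indicE; move: (nonint_neq0 h1) (nonint_neq0 h2).
  have -> : (x \in `]- beta, beta[%classic) = (0 < x + beta) && (0 < - x + beta).
    by apply/idP/idP; rewrite inE/= in_itv/=; lra.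
  by case: (ltgtP (x + beta) 0) => // a; case: (ltgtP (- x + beta) 0) => // b _ _;
    rewrite ?(gtr0_sg a) ?(gtr0_sg b) ?(ltr0_sg a) ?(ltr0_sg b)/=; lra.
by rewrite /BSr !H// /symm; ring.
Qed.

Definition weighted s beta x : R := fejer x * Hpm_reg s (x + beta).

Lemma integrable_weighted s beta : mu.-integrable setT (EFin \o weighted s beta).
Proof.
apply: (@integrable_fejerM _ _ 7); last by move=> x; exact: normr_Hpm_reg.
by apply: (measurableT_comp (@measurable_Hpm_reg s)); exact: measurable_funD.
Qed.

Lemma Rintegral_weighted s beta : 0 < beta -> \int[mu]_x weighted s beta x =
  1 + ((pi ^+ 2 * beta)^-1 - sin (2 * pi * beta) / (2 * pi ^+ 3 * beta ^+ 2))
  - (1 - (-1) ^+ s) * fejer_corr beta - 2 * corr_sum (beta + 1).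
Proof.
move=> /lt0r_neq0 b0.
pose e : R := 1 - (-1) ^+ s.
pose f1 x : R := fejer x * (2 * (sinsq (x + beta) / (x + beta))).
pose f2 x : R := fejer x * fejer (x + beta).
pose f3 x : R := fejer x * (sinsq (x + (beta + 1)) * trigamma (x + (beta + 1))).
have i0 := integrable_fejer R.
have i1 : mu.-integrable setT (EFin \o f1).
  apply: (@integrable_fejerM _ _ 2).
    apply: measurable_funM => //; apply: (measurableT_comp measurable_sinsq_div).
    exact: measurable_funD.
  move=> x; rewrite normrM ger0_norm// -[leRHS]mulr1 ler_wpM2l//.
  exact: normr_sinsq_div.
have i2 : mu.-integrable setT (EFin \o f2) by exact: integrable_fejerM_shift.
have i3 : mu.-integrable setT (EFin \o f3) by exact: integrable_corr_sum.
have j2 : mu.-integrable setT (EFin \o (fun x => e * f2 x)).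
  exact: (integrableZl measurableT e i2).
have j3 : mu.-integrable setT (EFin \o (fun x => 2 * f3 x)).
  exact: (integrableZl measurableT 2 i3).
have j01 : mu.-integrable setT (EFin \o (fun x => fejer x + f1 x)).
  exact: (integrableD measurableT i0 i1).
have j012 : mu.-integrable setT (EFin \o (fun x => fejer x + f1 x - e * f2 x)).
  exact: (integrableB measurableT j01 j2).
transitivity (\int[mu]_x (fejer x + f1 x - e * f2 x - 2 * f3 x)).
  by apply: eq_Rintegral => x _; rewrite /weighted /Hpm_reg /f1 /f2 /f3 !addrA /e; ring.
rewrite RintegralB// RintegralB// RintegralD// !RintegralZl//.
by rewrite Rintegral_fejer Rintegral_fejerM_sinsq_div// Rintegral_fejerM_shift.
Qed.

Lemma integrable_BSr_reg s beta : mu.-integrable setT (EFin \o BSr_reg s beta).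
Proof.
have i1 := integrable_symm beta integrable_H0_excess.
have i2 : mu.-integrable setT (EFin \o \1_`]- beta, beta[) by exact: integrable_indic_itv.
have i3 := integrable_symm beta (integrable_fejer R).
exact: (integrableD measurableT (integrableD measurableT i1 i2)
  (integrableZl measurableT ((-1) ^+ s) i3)).
Qed.

Lemma Rintegral_BSr_reg s beta : 0 < beta ->
  \int[mu]_x BSr_reg s beta x = 2 * beta + (-1) ^+ s.
Proof.
move=> b0.
have i1 := integrable_symm beta integrable_H0_excess.
have i2 : mu.-integrable setT (EFin \o \1_`]- beta, beta[) by exact: integrable_indic_itv.
have i3 := integrable_symm beta (integrable_fejer R).
rewrite RintegralD//; last 2 first.
- exact: (integrableD measurableT i1 i2).
- exact: (integrableZl measurableT ((-1) ^+ s) i3).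
rewrite RintegralD// [X in _ + X = _]RintegralZl// !Rintegral_symm//; last 2 first.
- exact: integrable_fejer.
- exact: integrable_H0_excess.
rewrite (Rintegral_odd integrable_H0_excess H0_excess_odd) add0r Rintegral_fejer mulr1.
congr (_ + _); rewrite /Rintegral integral_indic//.
by rewrite setIT /= lebesgue_measure_itv/= lte_fin ifT/=; [ring|lra].
Qed.

(** Off a countable set, r (1-K) = r - K r; the regular form BSr_reg stands for the
    first r and the symmetrized weighted function for K r, as K is even. *)
Lemma M_BSr s beta : 0 < beta ->
  M (BSr s beta) = 2 * beta + (-1) ^+ s - \int[mu]_x weighted s beta x.
Proof.
move=> b0.
pose w := weighted s beta.
have wi : mu.-integrable setT (EFin \o w) by exact: integrable_weighted.
have mw : measurable_fun [set: R] w by apply/measurable_EFinP; exact: measurable_int wi.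
have wNi : mu.-integrable setT (EFin \o (fun x => w (- x))) by exact: integrable_opp wi.
have si : mu.-integrable setT (EFin \o symm w 0) by exact: integrable_symm.
have ri := integrable_BSr_reg s beta.
pose N := [set x : R | x + beta \is a Num.int] `|`
  [set x : R | - x + beta \is a Num.int].
rewrite -(Rintegral_BSr_reg s b0) -[X in _ - X](Rintegral_symm 0 wi) -RintegralB//.
apply: (Rintegral_eq_off_countable (N := N)).
- rewrite /N -bigcup2E; apply: bigcup_countable => // -[|[|k]] _ //=.
  + by apply: (@countable_int _ (fun x => x + beta) (fun y => y - beta)) => x; rewrite addrK.
  + by apply: (@countable_int _ (fun x => - x + beta) (fun y => beta - y)) => x; ring.
- move=> x /not_orP[/negP h1 /negP h2].
  rewrite -BSr_regE// /symm !addr0 /w /weighted fejerN -!Hpm_regE// /BSr.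
  by rewrite -[(sin _ / _) ^+ 2]/(fejer x); ring.
- by apply/measurable_EFinP; exact: (measurable_int _ (integrableB measurableT ri si)).
Qed.

End Main.

Theorem theorem2 (R : realType) :
  exists C : R, forall (s : bool) (beta : R), 0 < beta ->
    2^-1 * M (BSr s beta) =
      (beta + (-1) ^+ s * 2^-1) - 1 / (2 * pi ^+ 2 * beta)
      + sin (2 * pi * beta) / (4 * pi ^+ 3 * beta ^+ 2)
      - 1 / (4 * pi ^+ 2) * bisum (fun n : int => term s n beta)
    /\
    `| 2^-1 * M (BSr s beta)
       - (beta - 2^-1 + (-1) ^+ s * 2^-1 + 1 / (2 * pi ^+ 2 * beta)) |
      <= C / beta ^+ 2.
Proof.
exists ((4 * pi ^+ 3)^-1 + 2 / pi ^+ 2 + (pi ^- 2 + (2 * pi ^+ 3)^-1)) => s beta b0.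
have p0 := pi_gt0 R; have pn0 := lt0r_neq0 p0; have bn0 := lt0r_neq0 b0.
rewrite M_BSr// Rintegral_weighted//; split.
  rewrite bisum_term; move: (sin _) (fejer_corr _) (corr_sum _) => S c T.
  by move: ((-1) ^+ s) pi pn0 => e p pn0; field; rewrite bn0 pn0.
have hs : `|sin (2 * pi * beta) / (4 * pi ^+ 3 * beta ^+ 2)| <=
    (4 * pi ^+ 3)^-1 / beta ^+ 2.
  rewrite normrM normfV (@ger0_norm _ (_ * _ ^+ 2)); last first.
    by rewrite !mulr_ge0 ?exprn_ge0// ltW.
  rewrite -invfM ler_piMl ?sin_max// invr_ge0 !mulr_ge0 ?exprn_ge0// ltW//.
have hc : `|2^-1 * (1 - (-1) ^+ s) * fejer_corr beta| <= 2 / pi ^+ 2 / beta ^+ 2.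
  have c0 := fejer_corr_ge0 beta; have c1 := fejer_corr_le bn0.
  have -> : 2 / pi ^+ 2 / beta ^+ 2 = 2 / (pi ^+ 2 * beta ^+ 2) :> R.
    by move: pi pn0 => p ?; field; apply/andP.
  apply: le_trans c1; case: s; rewrite ?expr1 ?expr0 ler_norml; apply/andP; split; lra.
have hT := corr_sum_asymptotic b0.
have -> : 2^-1 * (2 * beta + (-1) ^+ s -
     (1 + ((pi ^+ 2 * beta)^-1 - sin (2 * pi * beta) / (2 * pi ^+ 3 * beta ^+ 2)) -
      (1 - (-1) ^+ s) * fejer_corr beta - 2 * corr_sum (beta + 1))) -
  (beta - 2^-1 + (-1) ^+ s * 2^-1 + 1 / (2 * pi ^+ 2 * beta)) =
  sin (2 * pi * beta) / (4 * pi ^+ 3 * beta ^+ 2) +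
  2^-1 * (1 - (-1) ^+ s) * fejer_corr beta +
  (corr_sum (beta + 1) - (pi ^+ 2 * beta)^-1).
  move: (sin _) (fejer_corr _) (corr_sum _) => S c T.
  by move: ((-1) ^+ s) pi pn0 => e p pn0; field; rewrite bn0 pn0.
rewrite !(mulrDl _ _ (beta ^- 2)); rewrite [leRHS]mulrDl in hT.
apply: (le_trans (ler_normD _ _)); rewrite lerD//.
by apply: (le_trans (ler_normD _ _)); rewrite lerD.
Qed.
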